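(* Let $A\in\mathbb{R}^{n\times n}$, $B\in\mathbb{R}^{n\times m}$ with $(A,B)$ stabilizable, let $Q\in\mathbb{R}^{n\times n}$ and $R\in\mathbb{R}^{m\times m}$ be symmetric positive definite, and let $\mathcal{G}=\{K\in\mathbb{R}^{m\times n}: A-BK\text{ is Hurwitz}\}$. For $K\in\mathcal{G}$ let $P_K$ be the solution of $(A-BK)^\top P_K+P_K(A-BK)+Q+K^\top RK=0$, and let $c(K)=1+\|Y^*\|\,\|BR^{-1}B^\top\|\,\mathrm{Tr}(P_K)$. If $0<\eta(k)\le\min\left\{1,\frac{1}{4c(K(k))}\right\}$, then the Gauss-Newton method $$K(k+1)=K(k)-\eta(k)\big(K(k)-R^{-1}B^\top P_{K(k)}+W(k)\big)$$ is small-disturbance input-to-state stable with respect to $W\in\ell_\infty^{m\times n}$.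
   Context: $\|\cdot\|$ is the spectral norm of a matrix, $\|\cdot\|_F$ the Frobenius norm. $\mathbb{R}_+=[0,\infty)$; $\mathbb{Z}_+$ is the set of nonnegative integers. $\ell_\infty^{m\times n}$ is the set of bounded functions $W:\mathbb{Z}_+\to\mathbb{R}^{m\times n}$ with $\|W\|_\infty=\sup_k\|W(k)\|_F$. LQR objects. The optimal gain is $K^*=R^{-1}B^\top P^*$, where $P^*$ is the symmetric positive definite solution of $A^\top P^*+P^*A+Q-P^*BR^{-1}B^\top P^*=0$; it minimizes $\mathcal{J}_2(K)=\mathrm{Tr}(P_K)$ over $\mathcal{G}$. $Y^*$ is the symmetric positive definite solution of $(A-BK^* )Y^*+Y^*(A-BK^* )^\top+I_n=0$. Comparison functions. $\alpha:\mathbb{R}_+\to\mathbb{R}_+$ is a $\mathcal{K}$-function if it is continuous, strictly increasing and $\alpha(0)=0$. For $d\in(0,\infty]$, $\alpha:[0,d)\to\mathbb{R}_+$ is a $\mathcal{K}_{[0,d)}$-function if it is continuous, strictly increasing and $\alpha(0)=0$. $\beta:\mathbb{R}_+\times\mathbb{R}_+\to\mathbb{R}_+$ is a $\mathcal{KL}$-function if $\beta(\cdot,t)$ is a $\mathcal{K}$-function for each fixed $t\ge0$ and, for each fixed $r\ge0$, $\beta(r,\cdot)$ is decreasing (in the non-strict sense) and tends to $0$ as $t\to\infty$. Size function. $\mathcal{V}:\mathcal{G}\to\mathbb{R}_+$ is a size function for $(\mathcal{G},K^* )$ if it is continuous; positive definite with respect to $K^*$ ($\mathcal{V}(K^* )=0$,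 $\mathcal{V}(K)>0$ for $K\ne K^*$); and coercive (for any sequence $\{K_k\}$ in $\mathcal{G}$ with $K_k\to\partial\mathcal{G}$ or $\|K_k\|_F\to\infty$, $\mathcal{V}(K_k)\to\infty$). Small-disturbance ISS. The algorithm (a discrete-time system with state $K(k)\in\mathcal{G}$, equilibrium $K^*$ and disturbance $W$) is small-disturbance input-to-state stable with respect to $W$ if there exist a size function $\mathcal{V}$ for $(\mathcal{G},K^* )$, a constant $d>0$ (possibly $\infty$), a $\mathcal{KL}$-function $\beta$ and a $\mathcal{K}_{[0,d)}$-function $\gamma$ such that for all $W$ with $\|W\|_\infty<d$ and all $K(0)\in\mathcal{G}$, $K(k)$ remains in $\mathcal{G}$ and $\mathcal{V}(K(k))\le\beta(\mathcal{V}(K(0)),k)+\gamma(\|W\|_\infty)$ for all $k\in\mathbb{Z}_+$.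
   Formalization: The claim fails for arbitrary positive step sizes (e.g. A=-1, B=0, η(k)=2^{-k}/4, W=0); the formal theorem adds that η(k) is bounded below by an envelope, depending on k and K(k), whose sum over k diverges uniformly on compact subsets of G. *)

(* Defs.v *)
From HB Require Import structures.
From mathcomp Require Export all_boot all_order all_algebra.
From mathcomp Require Export all_classical all_reals all_analysis.
From mathcomp Require Export complex.
Set Implicit Arguments.
Unset Strict Implicit.
Unset Printing Implicit Defensive.
Export Order.TTheory GRing.Theory Num.Theory.
Export numFieldNormedType.Exports.

Local Open Scope classical_set_scope.
Local Open Scope ring_scope.

Definition frob_norm (R : realType) (m n : nat) (A : 'M[R]_(m, n)) : R :=
  Num.sqrt (\sum_(i < m) \sum_(j < n) A i j ^+ 2).

(* On column vectors [frob_norm] is the Euclidean norm. *)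
Definition spectral_norm (R : realType) (m n : nat) (A : 'M[R]_(m, n)) : R :=
  sup [set frob_norm (A *m x) | x in [set x : 'cV[R]_n | frob_norm x <= 1]].

Definition bounded_signal (R : realType) (m n : nat)
    (W : nat -> 'M[R]_(m, n)) : Prop :=
  has_ubound (range (fun k => frob_norm (W k))).

(* Meaningful on bounded signals only: [sup] of an unbounded set is 0. *)
Definition linf_norm (R : realType) (m n : nat) (W : nat -> 'M[R]_(m, n)) : R :=
  sup (range (fun k => frob_norm (W k))).

Definition sym_posdef (R : realType) (n : nat) (A : 'M[R]_n) : Prop :=
  A^T = A /\ forall x : 'cV[R]_n, x != 0 -> 0 < (x^T *m A *m x) 0 0.

Definition Hurwitz (R : realType) (n : nat) (A : 'M[R]_n) : Prop :=
  forall z : R[i], eigenvalue (map_mx (real_complex R) A) z -> complex.Re z < 0.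

Definition stabilizing (R : realType) (n m : nat)
    (A : 'M[R]_n) (B : 'M[R]_(n, m)) : set 'M[R]_(m, n) :=
  [set K | Hurwitz (A - B *m K)].

Definition stabilizable (R : realType) (n m : nat)
    (A : 'M[R]_n) (B : 'M[R]_(n, m)) : Prop :=
  exists K : 'M[R]_(m, n), Hurwitz (A - B *m K).

(* [xget 0 S] is an element of S if there is one, and 0 otherwise; it renders
   "the solution of", each equation below having exactly one solution of the
   required kind in the situations considered. *)
Section LQR.
Variables (R : realType) (n m : nat).
Variables (A : 'M[R]_n) (B : 'M[R]_(n, m)) (Q : 'M[R]_n) (Rw : 'M[R]_m).

Definition lqr_P (K : 'M[R]_(m, n)) : 'M[R]_n :=
  xget 0 [set P : 'M[R]_n |
    (A - B *m K)^T *m P + P *m (A - B *m K) + Q + K^T *m Rw *m K = 0].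

Definition opt_P : 'M[R]_n :=
  xget 0 [set P : 'M[R]_n | sym_posdef P /\
    A^T *m P + P *m A + Q - P *m B *m invmx Rw *m B^T *m P = 0].

Definition opt_gain : 'M[R]_(m, n) := invmx Rw *m B^T *m opt_P.

Definition opt_Y : 'M[R]_n :=
  xget 0 [set Y : 'M[R]_n | sym_posdef Y /\
    (A - B *m opt_gain) *m Y + Y *m (A - B *m opt_gain)^T + 1%:M = 0].

Definition lqr_c (K : 'M[R]_(m, n)) : R :=
  1 + spectral_norm opt_Y * spectral_norm (B *m invmx Rw *m B^T)
      * \tr (lqr_P K).

(* The Gauss-Newton update K1 of the gain K under the disturbance W, with any
   step size eta such that 0 < eta <= min {1, 1 / (4 c(K))} and lo <= eta. *)
Definition gauss_newton_step (lo : R) (K W K1 : 'M[R]_(m, n)) : Prop :=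
  exists eta : R, [/\ 0 < eta, eta <= Num.min 1 (1 / (4 * lqr_c K)), lo <= eta
    & K1 = K - eta *: (K - invmx Rw *m B^T *m lqr_P K + W)].

End LQR.

(* For d = +oo this is the class of K-functions.  Values in [0, +oo[ follow
   from monotonicity and alpha 0 = 0; values off the domain are irrelevant. *)
Definition classK_on (R : realType) (d : \bar R) (alpha : R -> R) : Prop :=
  let D := [set r : R | 0 <= r /\ (r%:E < d)%E] in
  [/\ {within D, continuous alpha},
      {in D &, {homo alpha : x y / x < y}}
    & alpha 0 = 0].

Definition classKL (R : realType) (beta : R -> R -> R) : Prop :=
  (forall t : R, 0 <= t -> classK_on +oo%E (beta ^~ t)) /\
  (forall r : R, 0 <= r ->
     (forall s t : R, 0 <= s -> s <= t -> beta r t <= beta r s) /\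
     beta r t @[t --> +oo] --> 0).

Definition frontier (T : topologicalType) (G : set T) : set T :=
  closure G `\` interior G.

(* K_k -> frontier of G in the sense that the distance tends to 0; no sequence
   does so when the frontier is empty. *)
Definition tends_to_frontier (R : realType) (m n : nat)
    (G : set 'M[R]_(m, n)) (Ks : nat -> 'M[R]_(m, n)) : Prop :=
  forall e : R, 0 < e ->
    \forall k \near \oo, exists2 L : 'M[R]_(m, n), frontier G L & frob_norm (Ks k - L) < e.

Definition size_function (R : realType) (m n : nat)
    (G : set 'M[R]_(m, n)) (Kst : 'M[R]_(m, n)) (V : 'M[R]_(m, n) -> R) : Prop :=
  [/\ forall K, G K -> 0 <= V K,
      {within G, continuous V},
      V Kst = 0,
      forall K, G K -> K != Kst -> 0 < V K
    & forall Ks : nat -> 'M[R]_(m, n), (forall k, G (Ks k)) ->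
        (tends_to_frontier G Ks \/ frob_norm (Ks k) @[k --> \oo] --> +oo) ->
        V (Ks k) @[k --> \oo] --> +oo].

(* The dynamics is given by its one-step relation: [step k K W K1] says that
   the gain K at time k and the disturbance W may lead to K1 at time k + 1.
   The bound at time k only requires the run to be admissible up to time k. *)
Definition small_disturbance_ISS (R : realType) (m n : nat)
    (G : set 'M[R]_(m, n)) (Kst : 'M[R]_(m, n))
    (step : nat -> 'M[R]_(m, n) -> 'M[R]_(m, n) -> 'M[R]_(m, n) -> Prop) : Prop :=
  exists (V : 'M[R]_(m, n) -> R) (d : \bar R) (beta : R -> R -> R)
      (gamma : R -> R),
    [/\ size_function G Kst V, (0 < d)%E, classKL beta, classK_on d gamma
      & forall W : nat -> 'M[R]_(m, n), bounded_signal W ->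
          ((linf_norm W)%:E < d)%E ->
        forall K : nat -> 'M[R]_(m, n), G (K 0%N) ->
        forall k : nat,
          (forall j : nat, (j < k)%N -> step j (K j) (W j) (K j.+1)) ->
          G (K k) /\
          V (K k) <= beta (V (K 0%N)) k%:R + gamma (linf_norm W)].

(* A lower envelope [lo] for the step sizes along which the total step length
   is infinite, uniformly on compact subsets of G.  Without such a condition
   step sizes like 2^-k are allowed, the undisturbed iteration stalls away from
   the optimal gain, and no KL bound can hold.  It holds in particular for a
   continuous lo : G -> ]0, +oo[ independent of k, and for a positive sequence
   lo(k) with divergent sum. *)
Definition nonsummable_steps (R : realType) (m n : nat)
    (G : set 'M[R]_(m, n)) (lo : nat -> 'M[R]_(m, n) -> R) : Prop :=
  forall C : set 'M[R]_(m, n), compact C -> C `<=` G ->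
    exists e : nat -> R,
      (forall k K, C K -> e k <= lo k K) /\
      (\sum_(0 <= k < N) e k) @[N --> \oo] --> +oo.

(* Main.v *)
From HB Require Import structures.
Require Import Defs.
From mathcomp Require Import ring lra.
Local Open Scope classical_set_scope.
Local Open Scope ring_scope.
Set Implicit Arguments.
Unset Strict Implicit.
Unset Printing Implicit Defensive.

(** Notation: P_K is the cost matrix of a stabilizing gain K, Kst the optimal
    gain, Pst its cost matrix, M = K - R^-1 B^T P_K the residual of K, and
    E = K - Kst.  Gains are measured by |C|^2 = Tr (Yst C^T R C), with inner
    product <., .>, and gap = Tr P_K - Tr Pst.

    The squared distance |E|^2 decreases by itself.  Pairing the Lyapunov
    equation of P_K - Pst along the optimal closed loop with Yst gives
    2 <E, M> = |E|^2 + gap ([inner_residual]) and |M|^2 <= c(K) gap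
    ([residual_le_gap]).  With eta <= 1 / (4 c(K)) the second order term
    eta^2 |M|^2 of |E - eta (M + W)|^2 is absorbed, and one step loses
    eta / 2 (|E|^2 + gap) at the price of 4 eta |W|^2 ([distance_step]).

    This distance does not see the boundary of the stabilizing set; Tr P_K
    does.  Completing the square shows that for every gain L
      (A - BL)^T P_K + P_K (A - BL)
        = - (Q + L^T R L) + D^T R D - M^T R M,   D = L - R^-1 B^T P_K.
    For L = K - eta (M + W) one finds D = (1 - eta) M - eta W, so that by
    convexity D^T R D - M^T R M is at most eta W^T R W.  If W^T R W is small
    compared with Q, then P_K is still a Lyapunov function for L: the run stays
    in the stabilizing set and Tr P grows by a factor 1 + O(eta w^2) at most,
    with w a bound for the Frobenius norm of W.

    This factor multiplies a quantity which can be arbitrarily large, so the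
    effect of the disturbance is uniform only after taking logarithms.  The size
    function is therefore
      U = |E|^2 + ln (1 + Tr P_K) - ln (1 + Tr Pst)   ([lqr_size]).
    As the logarithmic part is at most gap, the decrease of |E|^2 pays for it
    too: U becomes at most (1 - eta / 2) U + eta C w^2 ([disturbed_step]).
    The same identity, applied to nearby L, shows that Tr P_K is continuous
    with compact sublevel sets ([sublevel_compact]), from which U is coercive.

    Iterating, U(k) <= prod (1 - eta_j / 2) U(0) + 2 C w^2.  The run stays in a
    compact sublevel set fixed by U(0), on which the step lengths have a
    divergent sum, hence the product tends to 0 at a rate given by this set.
    Countably many such rates are assembled into one KL function ([beta]).

    The Lyapunov theory behind this is algebraic: solvability comes from the
    Cayley-Hamilton theorem ([lyap_inj]), and positivity from deforming the
    matrix F into F - s I with s decreasing to 0 ([Hurwitz_certificate]). *)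

(** * Quadratic forms and semidefinite matrices *)

(** The case c = 0 is included because the forms to which this applies are only
    semidefinite. *)
Lemma discriminant_le (R : realType) (a b c : R) :
  0 <= c -> (forall t, 0 <= a + t * b *+ 2 + t ^+ 2 * c) -> b ^+ 2 <= a * c.
Proof.
rewrite le_eqVlt => /predU1P[<-|c_gt0] h.
  rewrite mulr0; case: (eqVneq b 0) => [->|b0]; first by rewrite expr0n.
  have := h (- (a + 1) / (b *+ 2)).
  have -> : a + - (a + 1) / (b *+ 2) * b *+ 2 + (- (a + 1) / (b *+ 2)) ^+ 2 * 0
            = - 1 by field.
  by rewrite oppr_ge0 ler10.
have := h (- b / c).
have -> : a + - b / c * b *+ 2 + (- b / c) ^+ 2 * c = (a * c - b ^+ 2) / c.
  by field; rewrite gt_eqF.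
by rewrite pmulr_lge0 ?invr_gt0 // subr_ge0.
Qed.

Lemma addmxE (R : nmodType) m n (A B : 'M[R]_(m, n)) i j :
  (A + B) i j = A i j + B i j.
Proof. by rewrite mxE. Qed.

Lemma oppmxE (R : zmodType) m n (A : 'M[R]_(m, n)) i j : (- A) i j = - A i j.
Proof. by rewrite mxE. Qed.

Lemma scalemxE (R : pzRingType) m n a (A : 'M[R]_(m, n)) i j :
  (a *: A) i j = a * A i j.
Proof. by rewrite mxE. Qed.

Lemma mx0E (R : nmodType) m n i j : (0 : 'M[R]_(m, n)) i j = 0.
Proof. by rewrite mxE. Qed.

Lemma trmxDE (R : nmodType) m n (A B : 'M[R]_(m, n)) : (A + B)^T = A^T + B^T.
Proof. by apply/matrixP => i j; rewrite !mxE. Qed.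

Lemma trmxNE (R : zmodType) m n (A : 'M[R]_(m, n)) : (- A)^T = - A^T.
Proof. by apply/matrixP => i j; rewrite !mxE. Qed.

Lemma trmxZE (R : pzRingType) m n a (A : 'M[R]_(m, n)) :
  (a *: A)^T = a *: A^T.
Proof. by apply/matrixP => i j; rewrite !mxE. Qed.

(** Identities between matrices are proved in two stages: products are expanded
    into sums of monomials, after which every entry of a monomial is an atom of
    a commutative ring. *)
Ltac mxexpand :=
  rewrite ?(trmxDE, trmxNE, trmxZE, trmx_mul, trmxK, trmx1);
  rewrite ?(mulmxDl, mulmxDr, mulmxBl, mulmxBr, mulNmx, mulmxN, mulmx1, mul1mx,
    mulmx0, mul0mx);
  rewrite -?(scalemxAl, scalemxAr) ?mulmxA.
Ltac mxring :=
  apply/matrixP => ? ?; rewrite ?(addmxE, oppmxE, scalemxE, mx0E); ring.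

Lemma normr_le_sqr (R : realDomainType) (a b : R) :
  `|a| <= b -> a ^+ 2 <= b ^+ 2.
Proof.
move=> h; rewrite -(real_normK (num_real a)) lerXn2r ?nnegrE //.
exact: le_trans h.
Qed.

Section Forms.
Variable R : realType.

Definition qf (n : nat) (Z : 'M[R]_n) (x : 'cV[R]_n) : R :=
  (x^T *m Z *m x) 0 0.

(** Symmetry is included because the Cauchy-Schwarz inequality [psd_CS] can
    fail for the bilinear form of a matrix with an antisymmetric part. *)
Definition psd (n : nat) (Z : 'M[R]_n) : Prop :=
  Z^T = Z /\ forall x, 0 <= qf Z x.

Lemma qf_tr n (Z : 'M[R]_n) x : qf Z x = \tr (Z *m (x *m x^T)).
Proof. by rewrite /qf mulmxA mxtrace_mulC mulmxA [RHS]big_ord1. Qed.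

Lemma qfD n (Y Z : 'M[R]_n) x : qf (Y + Z) x = qf Y x + qf Z x.
Proof. by rewrite !qf_tr mulmxDl linearD. Qed.

Lemma qfN n (Z : 'M[R]_n) x : qf (- Z) x = - qf Z x.
Proof. by rewrite !qf_tr mulNmx linearN. Qed.

Lemma qfB n (Y Z : 'M[R]_n) x : qf (Y - Z) x = qf Y x - qf Z x.
Proof. by rewrite qfD qfN. Qed.

Lemma qfZ n a (Z : 'M[R]_n) x : qf (a *: Z) x = a * qf Z x.
Proof. by rewrite !qf_tr -scalemxAl linearZ. Qed.

Lemma qf_congr m n (C : 'M[R]_(m, n)) Z x :
  qf (C^T *m Z *m C) x = qf Z (C *m x).
Proof. by rewrite /qf trmx_mul !mulmxA. Qed.

Lemma qfx0 n (Z : 'M[R]_n) : qf Z 0 = 0.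
Proof. by rewrite /qf mulmx0 mxE. Qed.

Lemma qf1_ge0 n (x : 'cV[R]_n) : 0 <= qf 1%:M x.
Proof.
rewrite /qf mulmx1 mxE sumr_ge0 // => i _.
by rewrite mxE -expr2 sqr_ge0.
Qed.

Lemma qf1_gt0 n (x : 'cV[R]_n) : x != 0 -> 0 < qf 1%:M x.
Proof.
move=> x0; rewrite lt_neqAle qf1_ge0 andbT eq_sym; apply: contraNneq x0.
rewrite /qf mulmx1 mxE => /psumr_eq0P h; apply/eqP/matrixP => i j.
have := h _ i isT; rewrite !ord1 !mxE => /(_ _)/eqP.
rewrite mulf_eq0 orbb => h1; apply/eqP/h1 => k _.
by rewrite mxE -expr2 sqr_ge0.
Qed.

Lemma psd1 n : psd (1%:M : 'M[R]_n).
Proof. by split=> [|x]; rewrite ?trmx1 // qf1_ge0. Qed.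

Lemma psd_congr m n (C : 'M[R]_(m, n)) Z : psd Z -> psd (C^T *m Z *m C).
Proof.
move=> [sZ hZ]; split=> [|x]; first by rewrite !trmx_mul trmxK sZ mulmxA.
by rewrite qf_congr.
Qed.

Lemma posdef_psd n (Z : 'M[R]_n) : sym_posdef Z -> psd Z.
Proof.
move=> [sZ hZ]; split=> // x.
by case: (eqVneq x 0) => [->|/hZ/ltW //]; rewrite qfx0.
Qed.

Lemma posdefD n (Y Z : 'M[R]_n) : sym_posdef Y -> psd Z -> sym_posdef (Y + Z).
Proof.
move=> [sY hY] [sZ hZ]; split=> [|x x0]; first by rewrite linearD /= sY sZ.
by rewrite -[X in 0 < X]/(qf (Y + Z) x) qfD ltr_wpDr // hY.
Qed.

Lemma posdef1 n : sym_posdef (1%:M : 'M[R]_n).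
Proof. by split=> [|x x0]; [exact: trmx1 | exact: (qf1_gt0 x0)]. Qed.

Lemma sym_bilin n (Z : 'M[R]_n) (x y : 'cV[R]_n) : Z^T = Z ->
  (y^T *m Z *m x) 0 0 = (x^T *m Z *m y) 0 0.
Proof.
move=> sZ; transitivity ((y^T *m Z *m x)^T 0 0); first by rewrite [RHS]mxE.
by rewrite !trmx_mul trmxK sZ mulmxA.
Qed.

Lemma qf_line n (Z : 'M[R]_n) (x y : 'cV[R]_n) t : Z^T = Z ->
  qf Z (x + t *: y) = qf Z x + t * (x^T *m Z *m y) 0 0 *+ 2 + t ^+ 2 * qf Z y.
Proof.
move=> sZ; have := sym_bilin x y sZ; rewrite /qf; mxexpand.
by rewrite !(addmxE, scalemxE) => ->; ring.
Qed.

Lemma qfxZ n (Z : 'M[R]_n) s (x : 'cV[R]_n) : qf Z (s *: x) = s ^+ 2 * qf Z x.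
Proof. by rewrite /qf; mxexpand; rewrite !scalemxE; ring. Qed.

Lemma bilinZl n (Z : 'M[R]_n) s (x y : 'cV[R]_n) :
  ((s *: x)^T *m Z *m y) 0 0 = s * (x^T *m Z *m y) 0 0.
Proof. by mxexpand; rewrite scalemxE. Qed.

Lemma psd_CS n (Z : 'M[R]_n) (x y : 'cV[R]_n) : psd Z ->
  (x^T *m Z *m y) 0 0 ^+ 2 <= qf Z x * qf Z y.
Proof.
move=> [sZ hZ]; apply: discriminant_le => // t.
by rewrite -qf_line.
Qed.

(** Cauchy-Schwarz against the vector Z x itself. *)
Lemma psd_qf_eq0 n (Z : 'M[R]_n) x : psd Z -> qf Z x = 0 -> Z *m x = 0.
Proof.
move=> pZ q0; have [sZ _] := pZ.
have := psd_CS (Z *m x) x pZ; rewrite q0 mulr0.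
have -> : (Z *m x)^T *m Z *m x = (Z *m x)^T *m 1%:M *m (Z *m x).
  by rewrite mulmx1 !mulmxA.
rewrite -/(qf _ _) => h; apply/eqP; apply: contraLR h => /qf1_gt0 h.
by rewrite -ltNge exprn_gt0.
Qed.

Lemma qf_delta n (Z : 'M[R]_n) i : qf Z (delta_mx i 0) = Z i i.
Proof. by rewrite /qf trmx_delta -rowE -colE !mxE. Qed.

Lemma psd_diag n (Z : 'M[R]_n) i : psd Z -> 0 <= Z i i.
Proof. by move=> [_ /(_ (delta_mx i 0))]; rewrite qf_delta. Qed.

Lemma psd_entry n (Z : 'M[R]_n) i j : psd Z -> Z i j ^+ 2 <= Z i i * Z j j.
Proof.
move=> /(psd_CS (delta_mx i 0) (delta_mx j 0)); rewrite /qf !trmx_delta.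
by rewrite -!rowE -!colE !mxE.
Qed.

Lemma psd_tr_ge0 n (Z : 'M[R]_n) : psd Z -> 0 <= \tr Z.
Proof. by move=> pZ; rewrite /mxtrace sumr_ge0 // => i _; apply: psd_diag. Qed.

Lemma psd_tr_eq0 n (Z : 'M[R]_n) : psd Z -> \tr Z = 0 -> Z = 0.
Proof.
move=> pZ /psumr_eq0P h; apply/matrixP => i j; rewrite mxE.
have := psd_entry i j pZ.
rewrite h ?mul0r//; last by move=> k _; apply: psd_diag.
by rewrite real_exprn_even_le0 ?num_real//= => /eqP.
Qed.

(** A semidefinite matrix is a finite sum of rank one squares: subtracting
    z z^T / Z_ii, where z is the i-th column, leaves a semidefinite matrix by
    Cauchy-Schwarz, kills the diagonal entry i and revives no other one. *)
Lemma psd_ind n (P : 'M[R]_n -> Prop) :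
  P 0 -> (forall Z (z : 'cV[R]_n) (a : R), psd Z -> 0 <= a -> P Z ->
    P (Z + a *: (z *m z^T))) ->
  forall Z, psd Z -> P Z.
Proof.
move=> P0 Pz Z; have [k] := ubnP #|[pred i | Z i i != 0]|.
elim: k Z => // k IH Z; rewrite ltnS => le_k pZ; have [sZ hZ] := pZ.
case: (pickP (fun i => Z i i != 0)) => [i i0|h]; last first.
  have -> // : Z = 0; apply: psd_tr_eq0 => //.
  by apply: big1 => i _; apply/eqP/negbFE/h.
pose z := col i Z; pose a := (Z i i)^-1.
have a_gt0 : 0 < a by rewrite invr_gt0 lt_neqAle eq_sym i0 psd_diag.
pose Y := Z - a *: (z *m z^T).
have pY : psd Y.
  split=> [|x]; first by rewrite /Y; mxexpand; rewrite sZ.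
  have := psd_CS (delta_mx i 0) x pZ; rewrite qf_delta trmx_delta.
  have -> : delta_mx 0 i *m Z = z^T.
    by rewrite -rowE; apply/rowP => j; rewrite !mxE -{1}sZ mxE.
  move=> h; rewrite qfB qfZ subr_ge0 ler_pdivrMl; last by rewrite -invr_gt0.
  suff -> : qf (z *m z^T) x = (z^T *m x) 0 0 ^+ 2 by [].
  rewrite /qf mulmxA -mulmxA mxE big_ord1 expr2; congr (_ * _).
  by rewrite -[x^T *m z]trmxK trmx_mul trmxK mxE.
have -> : Z = Y + a *: (z *m z^T) by rewrite subrK.
apply: Pz => //; first exact: ltW.
apply: IH => //; apply: leq_trans le_k; apply: proper_card.
have Yd j : Y j j = Z j j - a * Z j i ^+ 2.
  by rewrite /Y addmxE oppmxE scalemxE mxE big_ord1 !mxE expr2.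
apply/properP; split.
  apply/fintype.subsetP => j; rewrite !unfold_in /=; apply: contraNneq => j0.
  apply/eqP; apply: le_anti; rewrite psd_diag // andbT Yd j0 sub0r oppr_le0.
  by rewrite mulr_ge0 ?sqr_ge0 // ltW.
exists i; first by rewrite unfold_in.
by rewrite unfold_in /= Yd /a negbK expr2 mulKf ?subrr.
Qed.

(** On a rank one square the trace is a value of the form of Y. *)
Lemma psd_tr_mul_ge0 n (Y Z : 'M[R]_n) : psd Y -> psd Z -> 0 <= \tr (Y *m Z).
Proof.
move=> [_ hY] pZ; move: Z pZ; apply: psd_ind; first by rewrite mulmx0 mxtrace0.
move=> Z z a _ a0 h; rewrite mulmxDr linearD /= addr_ge0 //.
by rewrite -scalemxAr linearZ /= mulr_ge0 // -qf_tr.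
Qed.

Lemma psd_tr_mul_le n (X Y Z : 'M[R]_n) : psd (Y - X) -> psd Z ->
  \tr (X *m Z) <= \tr (Y *m Z).
Proof.
move=> pYX pZ; rewrite -subr_ge0 -linearB -mulmxBl /=.
exact: psd_tr_mul_ge0.
Qed.

Lemma psd_tr_le n (X Y : 'M[R]_n) : psd (Y - X) -> \tr X <= \tr Y.
Proof. by move=> /psd_tr_ge0; rewrite linearB subr_ge0. Qed.

(** * The Frobenius norm *)

Lemma frob_sqr m n (A : 'M[R]_(m, n)) : frob_norm A ^+ 2 = \tr (A^T *m A).
Proof.
rewrite sqr_sqrtr; last by do 2![apply: sumr_ge0 => ? _]; rewrite sqr_ge0.
rewrite exchange_big; apply: eq_bigr => j _; rewrite mxE.
by apply: eq_bigr => i _; rewrite mxE expr2.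
Qed.

Lemma frob_ge0 m n (A : 'M[R]_(m, n)) : 0 <= frob_norm A.
Proof. exact: sqrtr_ge0. Qed.

Lemma frob_qf n (x : 'cV[R]_n) : frob_norm x ^+ 2 = qf 1%:M x.
Proof. by rewrite frob_sqr /qf mulmx1 [LHS]big_ord1. Qed.

Lemma frob_CS m n (A B : 'M[R]_(m, n)) :
  `|\tr (A^T *m B)| <= frob_norm A * frob_norm B.
Proof.
rewrite -(@ler_pXn2r _ 2) ?nnegrE ?mulr_ge0 ?frob_ge0 //.
rewrite real_normK ?num_real // exprMn !frob_sqr.
apply: discriminant_le => [|t]; first by rewrite -frob_sqr sqr_ge0.
have := sqr_ge0 (frob_norm (A + t *: B)); rewrite frob_sqr.
have -> : \tr ((A + t *: B)^T *m (A + t *: B)) =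
  \tr (A^T *m A) + t * \tr (A^T *m B) *+ 2 + t ^+ 2 * \tr (B^T *m B) => //.
have := mxtrace_tr (A^T *m B); rewrite trmx_mul trmxK; mxexpand.
rewrite !(mxtraceD, mxtraceZ) => ->; ring.
Qed.

Lemma frobM m n p (A : 'M[R]_(m, n)) (B : 'M[R]_(n, p)) :
  frob_norm (A *m B) <= frob_norm A * frob_norm B.
Proof.
rewrite -(@ler_pXn2r _ 2) ?nnegrE ?mulr_ge0 ?frob_ge0 //.
rewrite exprMn /frob_norm !sqr_sqrtr; try
  by do 2![apply: sumr_ge0 => ? _]; rewrite sqr_ge0.
rewrite mulr_suml ler_sum // => i _.
rewrite [X in _ * X]exchange_big /= mulr_sumr ler_sum // => j _.
have /normr_le_sqr := frob_CS (row i A)^T (col j B).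
rewrite exprMn /frob_norm !sqr_sqrtr; try
  by do 2![apply: sumr_ge0 => ? _]; rewrite sqr_ge0.
rewrite trmxK [\tr _]big_ord1 !mxE.
rewrite (eq_bigr (fun k => A i k * B k j)) => [|k _]; last by rewrite !mxE.
rewrite [X in _ <= X * _ -> _](eq_bigr (fun k => A i k ^+ 2)); last first.
  by move=> k _; rewrite big_ord1 !mxE.
by rewrite [X in _ <= _ * X -> _](eq_bigr (fun k => B k j ^+ 2)) // => k _;
  rewrite big_ord1 !mxE.
Qed.

Lemma frobD m n (A B : 'M[R]_(m, n)) :
  frob_norm (A + B) <= frob_norm A + frob_norm B.
Proof.
rewrite -(@ler_pXn2r _ 2) ?nnegrE ?addr_ge0 ?frob_ge0 //.
have h := le_trans (ler_norm _) (frob_CS A B).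
rewrite sqrrD !frob_sqr trmxDE mulmxDl !mulmxDr !mxtraceD.
have := mxtrace_tr (A^T *m B); rewrite trmx_mul trmxK => ->; lra.
Qed.

Lemma frobZ m n a (A : 'M[R]_(m, n)) : frob_norm (a *: A) = `|a| * frob_norm A.
Proof.
apply/eqP; rewrite -(@eqrXn2 _ 2) ?mulr_ge0 ?frob_ge0 //; apply/eqP.
rewrite exprMn !frob_sqr trmxZE -scalemxAl -scalemxAr !mxtraceZ.
by rewrite real_normK ?num_real //; ring.
Qed.

Lemma frobN m n (A : 'M[R]_(m, n)) : frob_norm (- A) = frob_norm A.
Proof. by rewrite -scaleN1r frobZ normrN1 mul1r. Qed.

Lemma frobB m n (A B : 'M[R]_(m, n)) :
  frob_norm (A - B) <= frob_norm A + frob_norm B.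
Proof. by rewrite -(frobN B) frobD. Qed.

Lemma frob_tr m n (A : 'M[R]_(m, n)) : frob_norm A^T = frob_norm A.
Proof.
apply/eqP; rewrite -(@eqrXn2 _ 2) ?frob_ge0 //; apply/eqP.
by rewrite !frob_sqr trmxK mxtrace_mulC.
Qed.

Lemma entry_le_frob m n (A : 'M[R]_(m, n)) i j : `|A i j| <= frob_norm A.
Proof.
rewrite -sqrtr_sqr ler_sqrt; last first.
  by do 2![apply: sumr_ge0 => ? _]; rewrite sqr_ge0.
rewrite (bigD1 i) //= (bigD1 j) //= -addrA lerDl addr_ge0 // sumr_ge0 // => k _.
  by rewrite sqr_ge0.
by rewrite sumr_ge0 // => l _; rewrite sqr_ge0.
Qed.

Lemma frob_eq0 m n (A : 'M[R]_(m, n)) : frob_norm A = 0 -> A = 0.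
Proof.
move=> A0; apply/matrixP => i j; rewrite mxE; apply/eqP.
by rewrite -normr_le0 -A0 entry_le_frob.
Qed.

Lemma frob_qf_mul m n (C : 'M[R]_(m, n)) x :
  qf 1%:M (C *m x) <= frob_norm C ^+ 2 * qf 1%:M x.
Proof.
by rewrite -!frob_qf -exprMn lerXn2r ?nnegrE ?mulr_ge0 ?frob_ge0 ?frobM.
Qed.

Lemma bilin_le_frob n (Z : 'M[R]_n) (x y : 'cV[R]_n) :
  `|(x^T *m Z *m y) 0 0| <= frob_norm Z * (frob_norm x * frob_norm y).
Proof.
have := frob_CS x (Z *m y); rewrite [\tr _]big_ord1 mulmxA => /le_trans; apply.
by rewrite mulrCA ler_wpM2l ?frob_ge0 // frobM.
Qed.

Lemma qf_le_frob n (Z : 'M[R]_n) x : `|qf Z x| <= frob_norm Z * qf 1%:M x.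
Proof. by rewrite -frob_qf expr2 bilin_le_frob. Qed.

Lemma psd_frob_le_tr n (Z : 'M[R]_n) : psd Z -> frob_norm Z <= \tr Z.
Proof.
move=> pZ; rewrite -(@ler_pXn2r _ 2) ?nnegrE ?frob_ge0 ?psd_tr_ge0 //.
rewrite /frob_norm sqr_sqrtr; last first.
  by do 2![apply: sumr_ge0 => ? _]; rewrite sqr_ge0.
rewrite expr2 [X in X * _]/mxtrace mulr_suml ler_sum // => i _.
rewrite mulr_sumr ler_sum // => j _; exact: psd_entry.
Qed.

Lemma posdef_unit n (Z : 'M[R]_n) : sym_posdef Z -> Z \in unitmx.
Proof.
move=> [sZ hZ]; rewrite -row_free_unit -kermx_eq0.
apply/eqP/row_matrixP => i; rewrite row0; apply/eqP; apply: contraT => x0.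
have := hZ (row i (kermx Z))^T; rewrite -trmx0 (inj_eq trmx_inj) => /(_ x0).
by rewrite trmxK -row_mul mulmx_ker row0 mul0mx mxE ltxx.
Qed.

(** By Cauchy-Schwarz for the form of Z between x and Z^-1 x,
    |x|^4 <= (x^T Z x) (x^T Z^-1 x), and the last factor is O(|x|^2). *)
Lemma posdef_coercive n (Z : 'M[R]_n) : sym_posdef Z ->
  exists2 c : R, 0 < c & forall x, c * qf 1%:M x <= qf Z x.
Proof.
move=> dZ; have pZ := posdef_psd dZ; have uZ := posdef_unit dZ.
pose f := 1 + frob_norm (invmx Z).
have f_gt0 : 0 < f by rewrite ltr_wpDr ?frob_ge0.
exists f^-1 => [|x]; first by rewrite invr_gt0.
case: (eqVneq x 0) => [->|x0]; first by rewrite !qfx0 mulr0.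
have x1 := qf1_gt0 x0; rewrite ler_pdivrMl //.
rewrite -(ler_pM2r x1) -expr2.
have := psd_CS x (invmx Z *m x) pZ.
rewrite -mulmxA mulKVmx // -{1}[x^T]mulmx1 -/(qf _ _) => /le_trans; apply.
have -> : qf Z (invmx Z *m x) = qf (invmx Z) x.
  have [sZ _] := dZ.
  rewrite /qf trmx_mul trmx_inv sZ -!mulmxA; congr ((_ *m _) 0 0).
  by rewrite mulKVmx.
rewrite [f * _]mulrC -mulrA ler_wpM2l //; first by case: pZ.
apply: le_trans (ler_norm _) _; apply: le_trans (qf_le_frob _ _) _.
by rewrite ler_wpM2r ?qf1_ge0 // /f lerDr.
Qed.

End Forms.

(** * Lyapunov equations and Hurwitz matrices *)
Lemma eigenvalueE (F : fieldType) n (g : 'M[F]_n) a :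
  eigenvalue g a = (g - a%:M \notin unitmx).
Proof. by rewrite /eigenvalue /eigenspace kermx_eq0 row_free_unit. Qed.

Lemma eigenvalue_tr (F : fieldType) n (g : 'M[F]_n) a :
  eigenvalue g^T a = eigenvalue g a.
Proof. by rewrite !eigenvalueE -unitmx_tr trmxDE trmxNE trmxK tr_scalar_mx. Qed.

Lemma eigenvalue_opp (F : fieldType) n (g : 'M[F]_n) a :
  eigenvalue (- g) a = eigenvalue g (- a).
Proof.
apply/eigenvalueP/eigenvalueP => -[v h v0]; exists v => //.
  by rewrite scaleNr -h mulmxN opprK.
by rewrite mulmxN h scaleNr opprK.
Qed.

Lemma eigenvalue_shift (F : fieldType) n (g : 'M[F]_n) s a :
  eigenvalue (g - s%:M) a = eigenvalue g (a + s).
Proof. by rewrite !eigenvalueE raddfD /= opprD [- a%:M - _]addrC addrA. Qed.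

Lemma shift_add (V : zmodType) n (F : 'M[V]_n) s t :
  F - (s + t)%:M = F - s%:M - t%:M.
Proof. by rewrite raddfD opprD addrA. Qed.

Section Lyapunov.
Variable R : realType.

Definition lyap (n : nat) (F P : 'M[R]_n) : 'M[R]_n := F^T *m P + P *m F.

Section Dim.
Variable n : nat.
Implicit Types F P X Y Z S : 'M[R]_n.

Lemma lyapD F X Y : lyap F (X + Y) = lyap F X + lyap F Y.
Proof. by rewrite /lyap; mxexpand; mxring. Qed.

Lemma lyapN F X : lyap F (- X) = - lyap F X.
Proof. by rewrite /lyap; mxexpand; mxring. Qed.

Lemma lyapB F X Y : lyap F (X - Y) = lyap F X - lyap F Y.
Proof. by rewrite lyapD lyapN. Qed.

Lemma lyapZ F a X : lyap F (a *: X) = a *: lyap F X.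
Proof. by rewrite /lyap; mxexpand; mxring. Qed.

Lemma lyap_shift F s X : lyap (F - s%:M) X = lyap F X - (s *+ 2) *: X.
Proof.
rewrite /lyap; mxexpand; rewrite tr_scalar_mx mul_scalar_mx mul_mx_scalar.
by mxring.
Qed.

Lemma Hurwitz_tr F : Hurwitz F -> Hurwitz F^T.
Proof. by move=> hF z; rewrite -map_trmx eigenvalue_tr; apply: hF. Qed.

Lemma Hurwitz_shift F s : 0 <= s -> Hurwitz F -> Hurwitz (F - s%:M).
Proof.
move=> s0 hF z; rewrite map_mxB map_scalar_mx eigenvalue_shift => /hF /=.
by case: z => a b /=; lra.
Qed.

(** Evaluate the form on the real part a and the imaginary part b of an
    eigenvector for p + i q: the terms in q cancel and the sum is 2 p times a
    positive number. *)
Lemma Hurwitz_of_lyap F P : sym_posdef P ->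
  (forall x, x != 0 -> qf (lyap F P) x < 0) -> Hurwitz F.
Proof.
move=> dP hP z.
have sP : P^T = P by case: dP.
have keyg (a b : 'cV[R]_n) p q :
    F *m a = p *: a - q *: b -> F *m b = q *: a + p *: b ->
    qf (lyap F P) a + qf (lyap F P) b = p *+ 2 * (qf P a + qf P b).
  move=> Fa Fb; have ab := sym_bilin a b sP.
  have e x : qf (lyap F P) x = ((F *m x)^T *m P *m x) 0 0 +
      (x^T *m P *m (F *m x)) 0 0.
    by rewrite /qf /lyap; mxexpand; rewrite addmxE.
  rewrite !e Fa Fb; mxexpand.
  rewrite !(addmxE, oppmxE, scalemxE) /qf ab; ring.
rewrite -eigenvalue_tr => /eigenvalueP[v vF v0].
pose a := (map_mx (@complex.Re R) v)^T; pose b := (map_mx (@complex.Im R) v)^T.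
case: z vF => p q vF /=.
have entry j : (v *m (map_mx (real_complex R) F)^T) 0 j =
    Complex ((F *m a) j 0) ((F *m b) j 0).
  rewrite !mxE (eq_bigr (fun k => Complex (F j k * a k 0) (F j k * b k 0))).
    elim/big_ind3: _ => // [x1 x2 x3 y1 y2 y3 -> ->] //.
  by move=> k _; rewrite !mxE; case: (v 0 k) => c d; rewrite /= mulrC; simpc.
have [Fa Fb] : F *m a = p *: a - q *: b /\ F *m b = q *: a + p *: b.
  split; apply/colP => j; have := entry j; rewrite vF !mxE.
    case: (v 0 j) => c d /(congr1 (@complex.Re R)) /= <-; ring.
  case: (v 0 j) => c d /(congr1 (@complex.Im R)) /= <-; ring.
have key := keyg _ _ _ _ Fa Fb.
have ge0 x : 0 <= qf P x by have [] := posdef_psd dP.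
have le0 x : qf (lyap F P) x <= 0.
  by case: (eqVneq x 0) => [->|/hP/ltW//]; rewrite qfx0.
have : (a != 0) || (b != 0).
  apply: contraNT v0; rewrite negb_or !negbK => /andP[/eqP a0 /eqP b0].
  apply/eqP/rowP => j; have := congr1 (fun M : 'cV[R]_n => M j 0) a0.
  have := congr1 (fun M : 'cV[R]_n => M j 0) b0; rewrite !mxE.
  by case: (v 0 j) => c d /= -> ->.
suff : qf (lyap F P) a + qf (lyap F P) b < 0 -> p < 0.
  move=> h /orP[] x0; apply: h; have := hP _ x0.
    by have := le0 b; lra.
  by have := le0 a; lra.
rewrite key => h; rewrite ltNge; apply/negP => p0; move: h.
by rewrite ltNge mulr_ge0 ?addr_ge0 ?mulrn_wge0.
Qed.

End Dim.

(** The equation says X F = - F^T X over the complex numbers, hence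
    X chi(F) = chi(- F^T) X for the characteristic polynomial chi of F.  The
    left side vanishes, and chi(- F^T) is invertible because its eigenvalues are
    products of numbers - y - z with y and z eigenvalues of F. *)
Lemma lyap_inj n (F X : 'M[R]_n) : Hurwitz F -> lyap F X = 0 -> X = 0.
Proof.
case: n F X => [|n] F X hF h; first by apply/matrixP => -[].
pose Fc := map_mx (real_complex R) F; pose Xc := map_mx (real_complex R) X.
pose G := - Fc^T.
have GX : Xc *m Fc = G *m Xc.
  apply/eqP; rewrite mulNmx -subr_eq0 opprK addrC /Fc /Xc.
  by rewrite map_trmx -!map_mxM -map_mxD -/(lyap F X) h map_mx0.
have [s ps] := closed_field_poly_normal (char_poly Fc).
rewrite (monicP (char_poly_monic Fc)) scale1r in ps.
have unitG z : z \in s -> G - z%:M \in unitmx.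
  move=> zs; rewrite -[_ \in _]negbK -eigenvalueE; apply/negP.
  rewrite eigenvalue_opp eigenvalue_tr => /hF Rz.
  have /hF : eigenvalue Fc z by rewrite eigenvalue_root_char ps root_prod_XsubC.
  by move: Rz; case: (z) => a b /=; lra.
have : Xc *m \prod_(z <- s) (Fc - z%:M) = 0.
  have := Cayley_Hamilton Fc; rewrite ps rmorph_prod /= => h0.
  rewrite -[RHS](mulmx0 _ Xc) -h0; congr (_ *m _).
  by apply: eq_bigr => z _; rewrite rmorphB /= horner_mx_X horner_mx_C.
suff H : Xc *m \prod_(z <- s) (Fc - z%:M) = 0 -> Xc = 0.
  move=> /H Xc0; apply/matrixP => i j.
  have := congr1 (fun M : 'M[R[i]]_n.+1 => M i j) Xc0.
  by rewrite !mxE => /(congr1 (@complex.Re R)).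
elim: s unitG {ps} => [|z s IH] unitG; first by rewrite big_nil mulmx1.
rewrite big_cons -[_ * _]/(_ *m _) mulmxA.
have -> : Xc *m (Fc - z%:M) = (G - z%:M) *m Xc.
  by rewrite mulmxBr mulmxBl GX scalar_mxC.
rewrite -mulmxA => /(congr1 (mulmx (invmx (G - z%:M)))).
rewrite mulKmx ?unitG ?mem_head // mulmx0; apply: IH => y ys.
by rewrite unitG // in_cons ys orbT.
Qed.

Section Dim2.
Variable n : nat.
Implicit Types F P X Y Z S : 'M[R]_n.

Lemma lyap_surj F S : Hurwitz F -> exists X, lyap F X = S.
Proof.
move=> hF.
have lin : linear (lyap F) by move=> a X Y; rewrite lyapD lyapZ.
pose L : {linear 'M[R]_n -> 'M[R]_n} := HB.pack (lyap F)
  (GRing.isLinear.Build R 'M[R]_n 'M[R]_n _ (lyap F) lin).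
have /row_fullP[C CL] : row_full (lin_mx L).
  rewrite row_full_unit -row_free_unit -kermx_eq0.
  apply/eqP/row_matrixP => i; rewrite row0.
  have : row i (kermx (lin_mx L)) *m lin_mx L = 0.
    by rewrite -row_mul mulmx_ker row0.
  rewrite -[row i _]vec_mxK mul_vec_lin => /(congr1 vec_mx).
  by rewrite mxvecK linear0 => /(lyap_inj hF) ->; rewrite linear0.
exists (vec_mx (mxvec S *m C)); apply: (can_inj mxvecK).
by rewrite -[LHS](mul_vec_lin L) vec_mxK -mulmxA CL mulmx1.
Qed.

Lemma lyap_uniq F X Y : Hurwitz F -> lyap F X = lyap F Y -> X = Y.
Proof.
move=> hF h; apply/eqP; rewrite -subr_eq0; apply/eqP/(lyap_inj hF).
by rewrite lyapB h subrr.
Qed.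

Lemma lyap_sym F X S : Hurwitz F -> S^T = S -> lyap F X = S -> X^T = X.
Proof.
move=> hF sS h; apply: (lyap_uniq hF); rewrite h -sS -h /lyap; mxexpand.
by rewrite addrC.
Qed.

(** On a null vector of the form of Z, which is a null vector of Z, the form of
    [lyap F Z] would vanish. *)
Lemma psd_posdef_of_lyap F Z : psd Z ->
  (forall x, x != 0 -> qf (lyap F Z) x < 0) -> sym_posdef Z.
Proof.
move=> pZ hZ; have [sZ Z0] := pZ; split=> // x x0; rewrite lt_neqAle.
rewrite -[X in (0 != X) && (0 <= X)]/(qf Z x) Z0 andbT eq_sym.
apply: contraTneq (hZ x x0) => /(psd_qf_eq0 pZ) Zx; rewrite -leNgt.
have xZ : x^T *m Z = 0 by rewrite -sZ -trmx_mul Zx trmx0.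
rewrite /qf /lyap mulmxDr mulmxDl !mulmxA -[_ *m Z *m x]mulmxA Zx mulmx0 xZ.
by rewrite !mul0mx add0r mxE.
Qed.

(** Positivity of solutions is first derived from a certificate, and only then
    is a certificate produced for every Hurwitz matrix; the two steps together
    give [psd_of_lyap] without integrating a matrix exponential. *)
Definition certificate F P :=
  sym_posdef P /\ forall x, x != 0 -> qf (lyap F P) x < 0.

(** Let t be the least nonnegative number for which X + t P is semidefinite.  If
    t were positive, X + t P would even be positive definite by
    [psd_posdef_of_lyap], and t could be decreased. *)
Lemma psd_of_certificate F P X : certificate F P -> X^T = X ->
  (forall x, qf (lyap F X) x <= 0) -> psd X.
Proof.
move=> [dP hP] sX hX; have [sP P0] := dP.
have [c c0 hc] := posdef_coercive dP.
pose T := [set t : R | 0 <= t /\ psd (X + t *: P)].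
have sXt t : (X + t *: P)^T = X + t *: P by rewrite trmxDE trmxZE sX sP.
have T0 : T !=set0.
  exists (frob_norm X / c); split=> [|].
    by rewrite divr_ge0 ?frob_ge0 ?ltW.
  split=> // x; rewrite qfD qfZ.
  have h1 : - (frob_norm X * qf 1%:M x) <= qf X x.
    rewrite lerNl; apply: le_trans (qf_le_frob X x).
    by rewrite -normrN ler_norm.
  have h2 : frob_norm X * qf 1%:M x <= frob_norm X / c * qf P x.
    by rewrite -mulrA ler_wpM2l ?frob_ge0 // ler_pdivlMl // hc.
  by lra.
have Tlb : lbound T 0 by move=> t [].
pose t := inf T.
have t0 : 0 <= t by apply: lb_le_inf.
have pZ : psd (X + t *: P).
  split=> // x; rewrite qfD qfZ.
  case: (eqVneq x 0) => [->|x0]; first by rewrite !qfx0 mulr0 addr0.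
  have Px : 0 < qf P x by apply: P0.
  suff : - qf X x / qf P x <= t by rewrite ler_pdivrMr //; lra.
  apply: lb_le_inf => // s [_ [_ /(_ x)]]; rewrite qfD qfZ ler_pdivrMr //; lra.
move: t0; rewrite le_eqVlt => /predU1P[t0|t0].
  by move: pZ; rewrite -t0 scale0r addr0.
have dZ : sym_posdef (X + t *: P).
  apply: (@psd_posdef_of_lyap F) pZ _ => x x0.
  rewrite lyapD lyapZ qfD qfZ; have := hX x.
  suff : t * qf (lyap F P) x < 0 by lra.
  by rewrite pmulr_rlt0 ?hP.
have [c' c'0 hc'] := posdef_coercive dZ.
pose f := frob_norm P + 1.
have f0 : 0 < f by rewrite ltr_wpDl ?frob_ge0.
pose d := Num.min t (c' / f).
have d0 : 0 < d by rewrite lt_min t0 divr_gt0.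
have : T (t - d).
  split; first by rewrite subr_ge0 ge_min lexx.
  split=> // x; have := hc' x; rewrite !qfD !qfZ.
  have := le_trans (ler_norm _) (qf_le_frob P x).
  have h3 := qf1_ge0 x.
  have : d * f <= c' by rewrite -ler_pdivlMr // ge_min lexx orbT.
  move=> h1 h2.
  have h4 : d * qf P x <= c' * qf 1%:M x.
    apply: le_trans (_ : d * (f * qf 1%:M x) <= _).
      by rewrite ler_wpM2l ?(ltW d0) // (le_trans h2) // ler_wpM2r // lerDl.
    by rewrite mulrA ler_wpM2r.
  by lra.
move=> /(ge_inf (ex_intro _ 0 Tlb)); rewrite -/t; lra.
Qed.

(** The identity certifies F - s I for large s.  Let s0 be the infimum of the
    certified s and X the solution of [lyap (F - s0 I) X = - I].  For s near s0
    the matrix [lyap (F - s I) X] is still negative: from s above s0 the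
    existing certificate shows that X is semidefinite, so that X certifies s0,
    and then also values of s below s0 unless s0 = 0. *)
Lemma Hurwitz_certificate F : Hurwitz F -> exists P, certificate F P.
Proof.
move=> hF; pose T := [set s : R | 0 <= s /\ exists P, certificate (F - s%:M) P].
have T0 : T !=set0.
  exists (frob_norm F + 1); split; first by rewrite addr_ge0 ?frob_ge0.
  exists 1%:M; split=> [|x x0]; first exact: posdef1.
  rewrite lyap_shift qfB qfZ /lyap mulmx1 mul1mx qfD.
  have hx := qf1_gt0 x0.
  have h1 := le_trans (ler_norm _) (qf_le_frob F x).
  have := le_trans (ler_norm _) (qf_le_frob F^T x); rewrite frob_tr; lra.
have Tlb : lbound T 0 by move=> t [].
have inf0 : 0 <= inf T by apply: lb_le_inf.
have hI : has_inf T by split=> //; exists 0.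
set s0 := inf T in inf0 *.
have hF0 := Hurwitz_shift inf0 hF.
have [X hX] := lyap_surj (- 1%:M) hF0.
have sX : X^T = X by apply: (lyap_sym hF0 _ hX); rewrite trmxNE trmx1.
pose f := frob_norm X *+ 2 + 1.
have f0 : 0 < f by rewrite ltr_wpDl // mulrn_wge0 ?frob_ge0.
have bX d x : 0 <= d -> d <= f^-1 -> d *+ 2 * `|qf X x| <= qf 1%:M x * (1 - d).
  move=> d0 df; have h := qf_le_frob X x; have x0 := qf1_ge0 x.
  have h1 : d * (f * qf 1%:M x) <= qf 1%:M x.
    by rewrite mulrA ler_piMl // -ler_pdivlMr // mul1r.
  have h2 : d * `|qf X x| <= d * (frob_norm X * qf 1%:M x) by rewrite ler_wpM2l.
  by rewrite /f in h1; lra.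
have pX : psd X.
  have fV0 : 0 < f^-1 by rewrite invr_gt0.
  have [s [s_ge0 [P cP]] lt_s] := inf_adherent fV0 hI.
  have le_s : s0 <= s by apply: ge_inf; [exists 0|split=> //; exists P].
  apply: psd_of_certificate cP sX _ => x.
  have -> : F - s%:M = (F - s0%:M) - (s - s0)%:M.
    by rewrite -shift_add [s0 + _]addrC subrK.
  rewrite lyap_shift hX qfB qfN qfZ.
  have d0 : 0 <= s - s0 by rewrite subr_ge0.
  have h1 : s - s0 <= f^-1 by rewrite lerBlDl ltW.
  have h2 := bX _ x d0 h1.
  have h4 : 0 <= (s - s0) * qf 1%:M x by rewrite mulr_ge0 ?qf1_ge0.
  have : - ((s - s0) *+ 2 * qf X x) <= (s - s0) *+ 2 * `|qf X x|.
    by rewrite -mulrN ler_wpM2l ?mulrn_wge0 // -normrN ler_norm.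
  lra.
have dX : sym_posdef X.
  apply: (@psd_posdef_of_lyap (F - s0%:M)) pX _ => x x0.
  rewrite hX qfN oppr_lt0.
  exact: qf1_gt0.
move: inf0; rewrite le_eqVlt => /predU1P[e0|s0_gt0].
  exists X; split=> // x x0.
  by move: hX; rewrite -e0 raddf0 subr0 => ->; rewrite qfN oppr_lt0 qf1_gt0.
pose d := Num.min s0 f^-1.
have d0 : 0 < d by rewrite lt_min s0_gt0 invr_gt0.
suff : T (s0 - d) by move=> /(ge_inf (ex_intro _ 0 Tlb)); rewrite -/s0; lra.
split; first by rewrite subr_ge0 ge_min lexx.
exists X; split=> // x x0.
have -> : F - (s0 + - d)%:M = (F - s0%:M) - (- d)%:M.
  exact: shift_add.
rewrite lyap_shift hX qfB qfN qfZ.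
have d1 : d <= f^-1 by rewrite ge_min lexx orbT.
have h2 := bX d x (ltW d0) d1.
have h3 : d * `|qf X x| >= d * qf X x by rewrite ler_wpM2l ?ler_norm // ltW.
have h4 : 0 < d * qf 1%:M x by rewrite mulr_gt0 ?qf1_gt0.
by lra.
Qed.

Lemma psd_of_lyap F X : Hurwitz F -> X^T = X ->
  (forall x, qf (lyap F X) x <= 0) -> psd X.
Proof. by move=> /Hurwitz_certificate[P cP]; apply: psd_of_certificate cP. Qed.

End Dim2.
End Lyapunov.

(** * Compact sets of matrices *)
Section MatrixTopology.
Variables (R : realType) (m n : nat).

Lemma frob_le_entries (M : 'M[R]_(m, n)) c : 0 <= c ->
  (forall i j, `|M i j| <= c) -> frob_norm M <= (m * n).+1%:R * c.
Proof.
move=> c0 h; rewrite -(@ler_pXn2r _ 2) ?nnegrE ?frob_ge0 ?mulr_ge0 ?ler0n //.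
rewrite /frob_norm sqr_sqrtr; last first.
  by do 2![apply: sumr_ge0 => ? _]; rewrite sqr_ge0.
apply: le_trans (_ : \sum_(i < m) \sum_(j < n) c ^+ 2 <= _).
  by do 2![apply: ler_sum => ? _]; apply: normr_le_sqr.
under eq_bigr do rewrite sumr_const card_ord.
rewrite sumr_const card_ord -mulrnA mulnC exprMn -[X in X <= _]mulr_natl.
rewrite ler_wpM2r ?sqr_ge0 // -natrX ler_nat expnS expn1.
by apply: leq_trans (leq_pmull _ _) => //; apply: leqnSn.
Qed.

Lemma frob_nbhsP (L : 'M[R]_(m, n)) (A : set 'M[R]_(m, n)) :
  nbhs L A <-> exists2 d, 0 < d & forall K, frob_norm (K - L) < d -> A K.
Proof.
split=> [/nbhs_ballP[e e0 he]|[d d0 hd]].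
  exists e => // K hK; apply: he; split=> // i j; rewrite /ball /= distrC.
  by have := entry_le_frob (K - L) i j; rewrite !mxE => /le_lt_trans; apply.
apply/nbhs_ballP; pose e := d / (m * n).+1%:R / 2.
have e0 : 0 < e by rewrite !divr_gt0.
exists e => // K [_ hK]; apply: hd.
apply: le_lt_trans (frob_le_entries (ltW e0) _) _.
  by move=> i j; have := hK i j; rewrite /ball /= distrC !mxE => /ltW.
by rewrite /e mulrC mulrAC mulfVK ?pnatr_eq0 //; lra.
Qed.

Lemma vec_mx_continuous : continuous (@vec_mx R m n).
Proof.
move=> v A /nbhs_ballP[e e0 he]; apply/nbhs_ballP; exists e => // w [_ hw].
by apply: he; split=> // i j; rewrite !mxE; apply: hw.
Qed.

Lemma frob_bounded_closed_compact (C : set 'M[R]_(m, n)) k :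
  closed C -> (forall M, C M -> frob_norm M <= k) -> compact C.
Proof.
move=> cC bC; have -> : C = vec_mx @` (vec_mx @^-1` C).
  apply/seteqP; split=> [M CM|_ [v Cv <-] //].
  by exists (mxvec M); rewrite /= mxvecK.
apply: continuous_compact.
  by apply: continuous_subspaceT => v; apply: vec_mx_continuous.
apply: bounded_closed_compact; last first.
  by apply: preimage_closed => // v _; apply: vec_mx_continuous.
exists k; split; first exact: num_real.
move=> x kx v /bC Cv /=; rewrite -[X in X <= _]/(mx_norm v) mx_normrE.
have x0 : 0 <= x.
  by apply: le_trans (ltW kx); apply: le_trans Cv; apply: frob_ge0.
apply/bigmax_leP; split=> // -[i l] _ /=; rewrite ord1.
case/mxvec_indexP: l => a b; apply: le_trans (ltW kx); apply: le_trans Cv.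
by have := entry_le_frob (vec_mx v) a b; rewrite mxE.
Qed.

End MatrixTopology.

(** * Cost matrices of stabilizing gains *)
Section LQR.
Variables (R : realType) (n m : nat).
Variables (A : 'M[R]_n) (B : 'M[R]_(n, m)) (Q : 'M[R]_n) (Rw : 'M[R]_m).
Hypotheses (hQ : sym_posdef Q) (hR : sym_posdef Rw).

Local Notation G := (stabilizing A B).
Local Notation P := (lqr_P A B Q Rw).
Implicit Types K L : 'M[R]_(m, n).

(** The gain minimizing L |-> [lyap (A - B L) X + stage_cost L]. *)
Definition greedy_gain (X : 'M[R]_n) : 'M[R]_(m, n) := invmx Rw *m B^T *m X.
Definition stage_cost L : 'M[R]_n := Q + L^T *m Rw *m L.
Definition gain_residual K : 'M[R]_(m, n) := K - greedy_gain (P K).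
Definition riccati (X : 'M[R]_n) : 'M[R]_n :=
  A^T *m X + X *m A + Q - X *m B *m invmx Rw *m B^T *m X.

Let sR : Rw^T = Rw. Proof. by case: hR. Qed.
Let uR : Rw \in unitmx. Proof. exact: posdef_unit. Qed.
Let pR : psd Rw. Proof. exact: posdef_psd. Qed.

Lemma posdef_cost L : sym_posdef (stage_cost L).
Proof. exact/posdefD/psd_congr. Qed.

Lemma qf_cost L x : qf (stage_cost L) x = qf Q x + qf Rw (L *m x).
Proof. by rewrite qfD qf_congr. Qed.

Lemma qf_cost_ge0 L x : 0 <= qf (stage_cost L) x.
Proof. by have [_] := posdef_psd (posdef_cost L). Qed.

(** All comparisons between gains below are instances of this identity. *)
Lemma complete_square X L : X^T = X ->
  lyap (A - B *m L) X + stage_cost L =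
  riccati X + (L - greedy_gain X)^T *m Rw *m (L - greedy_gain X).
Proof.
move=> sX; rewrite /lyap /stage_cost /riccati /greedy_gain; mxexpand.
rewrite trmx_inv sX sR !mulmxKV // mulmxK //.
by mxring.
Qed.

Lemma lqr_P_eqn K : G K -> lyap (A - B *m K) (P K) = - stage_cost K.
Proof.
move=> GK; have [X hX] := lyap_surj (- stage_cost K) GK.
have hS : [set X : 'M[R]_n | (A - B *m K)^T *m X + X *m (A - B *m K) + Q +
    K^T *m Rw *m K = 0] X.
  by rewrite /= -addrA -/(lyap _ _) hX addNr.
have := xgetPex 0 (ex_intro _ X hS).
rewrite /= -/(P K) -addrA -/(lyap _ _) => /eqP.
by rewrite addr_eq0 => /eqP.
Qed.

Lemma lqr_P_uniq K X : G K -> lyap (A - B *m K) X = - stage_cost K -> X = P K.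
Proof. by move=> GK hX; apply: (lyap_uniq GK); rewrite hX lqr_P_eqn. Qed.

Lemma lqr_P_sym K : G K -> (P K)^T = P K.
Proof.
move=> GK; apply: (lyap_sym GK _ (lqr_P_eqn GK)).
by have [sC _] := posdef_cost K; rewrite trmxNE sC.
Qed.

Lemma lqr_P_psd K : G K -> psd (P K).
Proof.
move=> GK; apply: (psd_of_lyap GK); first exact: lqr_P_sym.
by move=> x; rewrite lqr_P_eqn // qfN oppr_le0 qf_cost_ge0.
Qed.

Lemma lqr_P_posdef K : G K -> sym_posdef (P K).
Proof.
move=> GK; apply: (@psd_posdef_of_lyap _ _ (A - B *m K)).
  exact: lqr_P_psd.
move=> x x0; rewrite lqr_P_eqn // qfN oppr_lt0.
by have [_] := posdef_cost K; apply.
Qed.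

Lemma lqr_tr_ge0 K : G K -> 0 <= \tr (P K).
Proof. by move=> GK; apply/psd_tr_ge0/lqr_P_psd. Qed.

Lemma lyap_lqr_P K L : G K ->
  lyap (A - B *m L) (P K) = - stage_cost L
    + ((L - greedy_gain (P K))^T *m Rw *m (L - greedy_gain (P K))
       - (gain_residual K)^T *m Rw *m gain_residual K).
Proof.
move=> GK; have sP := lqr_P_sym GK.
have := complete_square K sP; rewrite lqr_P_eqn // addNr -/(gain_residual K).
move=> /esym/eqP; rewrite addrC addr_eq0 => /eqP ->; rewrite opprK.
have := complete_square L sP => /(congr1 (fun Z => Z - stage_cost L)).
rewrite addrK => ->; mxring.
Qed.

(** The error made when P_K serves as a Lyapunov function for L, see
    [qf_lyap_lqr_P]: if it is at most a fraction e < 1 of the cost of L, then L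
    is stabilizing and P_L is at most P_K / (1 - e). *)
Definition excess K L x : R :=
  qf Rw ((L - greedy_gain (P K)) *m x) - qf Rw (gain_residual K *m x).

Lemma qf_lyap_lqr_P K L x : G K ->
  qf (lyap (A - B *m L) (P K)) x = - qf (stage_cost L) x + excess K L x.
Proof. by move=> GK; rewrite lyap_lqr_P // qfD qfN qfB !qf_congr. Qed.

Lemma stabilizing_of_excess K L e : G K -> e < 1 ->
  (forall x, excess K L x <= e * qf (stage_cost L) x) -> G L.
Proof.
move=> GK e1 h; apply: Hurwitz_of_lyap (lqr_P_posdef GK) _ => x x0.
rewrite qf_lyap_lqr_P //; have := h x.
have : 0 < qf (stage_cost L) x by have [_] := posdef_cost L; apply.
move=> c0.
have : 0 < (1 - e) * qf (stage_cost L) x by rewrite mulr_gt0 ?subr_gt0.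
lra.
Qed.

Lemma tr_of_excess K L e : G K -> G L ->
  (forall x, excess K L x <= e * qf (stage_cost L) x) ->
  (1 - e) * \tr (P L) <= \tr (P K).
Proof.
move=> GK GL h; rewrite -mxtraceZ; apply: psd_tr_le.
apply: (psd_of_lyap GL).
  by rewrite trmxDE trmxNE trmxZE !lqr_P_sym.
move=> x; rewrite lyapB lyapZ qfB qfZ.
rewrite (qf_lyap_lqr_P _ _ GK) (lqr_P_eqn GL) qfN.
have := h x; lra.
Qed.

Lemma tr_of_excess_ge K L e : G K -> G L ->
  (forall x, - (e * qf (stage_cost L) x) <= excess K L x) ->
  \tr (P K) <= (1 + e) * \tr (P L).
Proof.
move=> GK GL h; rewrite -mxtraceZ; apply: psd_tr_le.
apply: (psd_of_lyap GL).
  by rewrite trmxDE trmxNE trmxZE !lqr_P_sym.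
move=> x; rewrite lyapB lyapZ qfB qfZ.
rewrite (qf_lyap_lqr_P _ _ GK) (lqr_P_eqn GL) qfN.
have := h x; lra.
Qed.

Lemma residual_bound K : G K ->
  frob_norm (gain_residual K) <=
    frob_norm K + frob_norm (invmx Rw *m B^T) * \tr (P K).
Proof.
move=> GK; apply: le_trans (frobB _ _) _; rewrite lerD2l.
apply: le_trans (frobM _ _) _; rewrite ler_wpM2l ?frob_ge0 //.
exact/psd_frob_le_tr/lqr_P_psd.
Qed.

(** The trace of the Lyapunov equation bounds Tr (K^T R K), quadratic in K, by
    2 |P_K| |A - B K|, which is linear in K when Tr P_K is bounded. *)
Lemma gain_bound (r : R) : exists k, forall K, G K -> \tr (P K) <= r ->
  frob_norm K <= k.
Proof.
have [c c0 hc] := posdef_coercive hR.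
pose a := frob_norm A; pose b := frob_norm B.
have a0 : 0 <= a by exact: frob_ge0.
have b0 : 0 <= b by exact: frob_ge0.
exists (1 + 2 * r * (a + b) / c) => K GK Kr.
set k := frob_norm K.
have r0 : 0 <= r := le_trans (lqr_tr_ge0 GK) Kr.
have h0 : 0 <= 2 * r * (a + b) / c.
  by rewrite divr_ge0 ?(ltW c0) ?mulr_ge0 ?addr_ge0.
(* For k > 1 the linear term a + b k is at most (a + b) k, and one factor k
   cancels. *)
have [k1|k1] := leP k 1; first by lra.
suff : k * c <= 2 * r * (a + b) by rewrite -ler_pdivlMr // => h; lra.
have F_le : frob_norm (A - B *m K) <= (a + b) * k.
  apply: le_trans (frobB _ _) _; rewrite mulrDl lerD ?frobM //.
  by rewrite ler_peMr // ltW.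
have PF : `|\tr (P K *m (A - B *m K))| <= r * ((a + b) * k).
  rewrite -{1}(lqr_P_sym GK); apply: le_trans (frob_CS _ _) _.
  apply: ler_pM; rewrite ?frob_ge0 //.
  by apply: le_trans Kr; apply/psd_frob_le_tr/lqr_P_psd.
have tr_lyap : \tr (lyap (A - B *m K) (P K)) = 2 * \tr (P K *m (A - B *m K)).
  rewrite mxtraceD -[\tr (_^T *m _)]mxtrace_tr trmx_mul trmxK lqr_P_sym //.
  by rewrite mulrDl mul1r.
have cK : c * k ^+ 2 <= \tr (stage_cost K).
  rewrite frob_sqr mxtraceD -[X in X <= _]add0r lerD ?psd_tr_ge0 //.
    exact: posdef_psd.
  have : psd (K^T *m (Rw - c%:M) *m K).
    apply: psd_congr; split; first by rewrite trmxDE trmxNE sR tr_scalar_mx.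
    by move=> x; rewrite -scalemx1 qfB qfZ subr_ge0 hc.
  rewrite mulmxBr mulmxBl => /psd_tr_le; rewrite mul_mx_scalar -scalemxAl.
  by rewrite mxtraceZ.
have : \tr (stage_cost K) <= 2 * (r * ((a + b) * k)).
  move: tr_lyap; rewrite lqr_P_eqn // raddfN /= => h.
  move: PF; rewrite ler_norml => /andP[h1 _]; lra.
move=> h; have k0 : 0 < k by lra.
rewrite -(ler_pM2r k0); apply: le_trans (_ : c * k ^+ 2 <= _); first by lra.
by apply: le_trans cK _; apply: le_trans h _; lra.
Qed.

(** With D = L - K the excess is 2 (M x)^T R D x + (D x)^T R D x, where the
    residual M is bounded on the sublevel set; it is of order |D| |x|^2. *)
Lemma excess_margin (r e : R) : 0 < e -> exists2 d, 0 < d & forall K L, G K ->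
  \tr (P K) <= r -> frob_norm (L - K) <= d ->
  forall x, `|excess K L x| <= e * qf (stage_cost L) x.
Proof.
move=> e0; have [k hk] := gain_bound r.
have [q q0 hq] := posdef_coercive hQ.
pose mu : R := `|k| + frob_norm (invmx Rw *m B^T) * `|r|.
have mu0 : 0 <= mu by rewrite addr_ge0 ?mulr_ge0 ?frob_ge0.
pose c := frob_norm Rw * (2 * mu + 1) + 1.
have Rw0 := frob_ge0 Rw.
have c0 : 0 < c by rewrite ltr_wpDl // mulr_ge0 // addr_ge0 // mulr_ge0.
pose d := Num.min 1 (e * q / c).
have d0 : 0 < d by rewrite lt_min ltr01 divr_gt0 // mulr_gt0.
exists d; first exact: d0.
move=> K L GK Kr LK x; set D := L - K in LK.
have Mmu : frob_norm (gain_residual K) <= mu.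
  apply: le_trans (residual_bound GK) _; apply: lerD.
    by apply: le_trans (hk _ GK Kr) (ler_norm _).
  by rewrite ler_wpM2l ?frob_ge0 // (le_trans Kr) // ler_norm.
have -> : excess K L x = ((gain_residual K *m x)^T *m Rw *m (D *m x)) 0 0 *+ 2
    + qf Rw (D *m x).
  rewrite /excess; have -> : L - greedy_gain (P K) = gain_residual K + D.
    by rewrite /gain_residual /D; mxring.
  have := qf_line (gain_residual K *m x) (D *m x) 1 sR.
  by rewrite scale1r -mulmxDl => ->; ring.
have x0 := frob_ge0 x.
have hx : frob_norm (D *m x) <= d * frob_norm x.
  by apply: le_trans (frobM _ _) _; rewrite ler_wpM2r.
have hm : frob_norm (gain_residual K *m x) <= mu * frob_norm x.
  by apply: le_trans (frobM _ _) _; rewrite ler_wpM2r.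
have h1 : `|((gain_residual K *m x)^T *m Rw *m (D *m x)) 0 0| <=
    frob_norm Rw * ((mu * frob_norm x) * (d * frob_norm x)).
  apply: le_trans (bilin_le_frob _ _ _) _; rewrite ler_wpM2l //.
  by apply: ler_pM; rewrite ?frob_ge0.
have h2 : `|qf Rw (D *m x)| <= frob_norm Rw * (d * (d * frob_norm x ^+ 2)).
  apply: le_trans (qf_le_frob _ _) _; rewrite ler_wpM2l // -frob_qf.
  rewrite mulrA -expr2 -exprMn lerXn2r ?nnegrE ?frob_ge0 //.
  by rewrite mulr_ge0 // ltW.
have h3 : frob_norm Rw * (d * (d * frob_norm x ^+ 2)) <=
    frob_norm Rw * (d * frob_norm x ^+ 2).
  rewrite ler_wpM2l // ler_piMl ?mulr_ge0 ?sqr_ge0 ?(ltW d0) //.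
  by rewrite ge_min lexx.
have h4 : d * c * frob_norm x ^+ 2 <= e * q * frob_norm x ^+ 2.
  by rewrite ler_wpM2r ?sqr_ge0 // -ler_pdivlMr // ge_min lexx orbT.
have h5 : e * (q * frob_norm x ^+ 2) <= e * qf (stage_cost L) x.
  rewrite ler_wpM2l ?(ltW e0) // frob_qf (le_trans (hq x)) // qf_cost lerDl.
  by case: pR.
have h6 : 0 <= d * frob_norm x ^+ 2 by rewrite mulr_ge0 ?sqr_ge0 ?(ltW d0).
apply: le_trans (ler_normD _ _) _; rewrite normrMn.
rewrite /c in h4; lra.
Qed.

(** The radius depends on K only through a bound for Tr P_K.  This uniformity
    gives at once openness, continuity, compactness of sublevel sets and a
    positive distance from them to the frontier. *)
Lemma sublevel_margin (r e : R) : 0 < e < 1 ->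
  exists2 d, 0 < d & forall K L, G K ->
  \tr (P K) <= r -> frob_norm (L - K) <= d ->
  [/\ G L, (1 - e) * \tr (P L) <= \tr (P K)
     & \tr (P K) <= (1 + e) * \tr (P L)].
Proof.
move=> /andP[e0 e1]; have [d d0 hd] := excess_margin r e0.
exists d; first exact: d0.
move=> K L GK Kr LK; have h := hd K L GK Kr LK.
have GL : G L.
  apply: (stabilizing_of_excess GK e1) => x.
  exact: le_trans (ler_norm _) (h x).
split=> //.
  by apply: tr_of_excess => // x; apply: le_trans (ler_norm _) (h x).
by apply: tr_of_excess_ge => // x; have := h x; rewrite ler_norml => /andP[].
Qed.

Lemma half01 : 0 < (2^-1 : R) < 1.
Proof. by apply/andP; split; lra. Qed.

Lemma stabilizing_open : open G.
Proof.
move=> K GK; apply/frob_nbhsP.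
have [d d0 hd] := sublevel_margin (\tr (P K)) half01.
exists d; first exact: d0.
by move=> L /ltW /(hd K L GK (lexx _))[].
Qed.

Lemma lqr_tr_continuous K : G K -> {for K, continuous (fun L => \tr (P L))}.
Proof.
move=> GK; apply: (proj2 (@cvgrPdist_le _ _ _ (nbhs K) (nbhs_filter K) _ _)).
move=> /= e e0.
set t := \tr (P K); have t0 : 0 <= t := lqr_tr_ge0 GK.
pose f := Num.min 2^-1 (e / (2 * t + 1)).
have t1 : 0 < 2 * t + 1 by lra.
have f0 : 0 < f by rewrite lt_min invr_gt0 ltr0n divr_gt0.
have f2 : f <= 2^-1 by rewrite ge_min lexx.
have f1 : 0 < f < 1 by apply/andP; split; lra.
have [d d0 hd] := sublevel_margin t f1.
apply/frob_nbhsP; exists d; first exact: d0.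
move=> L /ltW /(hd K L GK (lexx _))[GL h1 h2].
have fe : f * (2 * t + 1) <= e by rewrite -ler_pdivlMr // ge_min lexx orbT.
have l0 := lqr_tr_ge0 GL; rewrite -/t in h1 h2.
have l2 : \tr (P L) <= 2 * t.
  have : 0 <= (2^-1 - f) * \tr (P L) by rewrite mulr_ge0 ?subr_ge0.
  lra.
have l3 : f * \tr (P L) <= f * (2 * t) by rewrite ler_wpM2l // ltW.
by rewrite ler_norml; apply/andP; split; lra.
Qed.

Lemma sublevel_compact (r : R) : compact [set K | G K /\ \tr (P K) <= r].
Proof.
have [k hk] := gain_bound r.
apply: (@frob_bounded_closed_compact _ _ _ _ k); last first.
  by move=> K [GK]; apply: hk.
move=> L clL.
have near_L d : 0 < d ->
    exists K, [/\ G K, \tr (P K) <= r & frob_norm (L - K) <= d].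
  move=> d0; have [|K [[GK Kr] hK]] := clL [set K | frob_norm (K - L) < d].
    by apply/frob_nbhsP; exists d.
  by exists K; split=> //; rewrite -frobN opprB ltW.
have GL : G L.
  have [d d0 hd] := sublevel_margin r half01.
  by have [K [GK Kr /(hd _ _ GK Kr)[]]] := near_L d d0.
split=> //; apply/ler_addgt0Pl => e e0.
have l0 := lqr_tr_ge0 GL.
pose f := Num.min 2^-1 (e / (\tr (P L) + 1)).
have t1 : 0 < \tr (P L) + 1 by lra.
have f0 : 0 < f by rewrite lt_min invr_gt0 ltr0n divr_gt0.
have f2 : f <= 2^-1 by rewrite ge_min lexx.
have f1 : 0 < f < 1 by apply/andP; split; lra.
have fe : f * (\tr (P L) + 1) <= e by rewrite -ler_pdivlMr // ge_min lexx orbT.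
have [d d0 hd] := sublevel_margin r f1.
have [K [GK Kr /(hd _ _ GK Kr)[_ h _]]] := near_L d d0.
lra.
Qed.

End LQR.

(** * Spectral norm and duality *)
Section Spectral.
Variables (R : realType).

Lemma spectral_bound m n (S : 'M[R]_(m, n)) (x : 'cV[R]_n) :
  frob_norm (S *m x) <= spectral_norm S * frob_norm x.
Proof.
have ub : has_ubound
    [set frob_norm (S *m x) | x in [set x : 'cV[R]_n | frob_norm x <= 1]].
  exists (frob_norm S) => _ [y /= y1 <-]; apply: le_trans (frobM _ _) _.
  by rewrite ler_piMr ?frob_ge0.
have := frob_ge0 x; rewrite le_eqVlt.
move=> /predU1P[/esym/[dup] x0 /frob_eq0 ->|x0].
  by rewrite mulmx0 -(scale0r (0 : 'cV[R]_m)) frobZ normr0 mul0r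
             -(scale0r (0 : 'cV[R]_n)) frobZ normr0 mul0r mulr0.
rewrite -ler_pdivrMr //.
have -> : frob_norm (S *m x) / frob_norm x =
    frob_norm (S *m ((frob_norm x)^-1 *: x)).
  by rewrite -scalemxAr frobZ ger0_norm ?invr_ge0 ?frob_ge0 // mulrC.
apply: ub_le_sup => //; exists ((frob_norm x)^-1 *: x) => //=.
by rewrite frobZ ger0_norm ?invr_ge0 ?frob_ge0 // mulVf // gt_eqF.
Qed.

Lemma psd_spectral n (S : 'M[R]_n) : S^T = S ->
  psd (spectral_norm S *: 1%:M - S).
Proof.
move=> sS; split=> [|x]; first by rewrite trmxDE trmxNE trmxZE trmx1 sS.
rewrite qfB qfZ subr_ge0 -frob_qf.
have := frob_CS x (S *m x); rewrite [\tr _]big_ord1 mulmxA => h.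
apply: le_trans (le_trans (ler_norm _) h) _.
by rewrite expr2 mulrCA ler_wpM2l ?frob_ge0 // spectral_bound.
Qed.

Lemma spectral_ge0 m n (S : 'M[R]_(m, n)) : 0 <= spectral_norm S.
Proof.
apply: le_trans (_ : frob_norm (S *m (0 : 'cV[R]_n)) <= _).
  exact: frob_ge0.
apply: ub_le_sup; last first.
  by exists 0 => //=; rewrite -(scale0r (0 : 'cV[R]_n)) frobZ normr0 mul0r.
exists (frob_norm S) => _ [y /= y1 <-]; apply: le_trans (frobM _ _) _.
by rewrite ler_piMr ?frob_ge0.
Qed.

Lemma psd_inv n (S : 'M[R]_n) : sym_posdef S -> psd (invmx S).
Proof.
move=> dS; have [sS _] := dS; have uS := posdef_unit dS.
have := psd_congr (invmx S) (posdef_psd dS).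
by rewrite trmx_inv sS mulVmx // mul1mx.
Qed.

Lemma tr_lyap_dual n (F Y Z : 'M[R]_n) :
  \tr (Y *m lyap F Z) = \tr (lyap F^T Y *m Z).
Proof.
rewrite /lyap trmxK mulmxDr mulmxDl !mxtraceD addrC; congr (_ + _).
  by rewrite mulmxA mxtrace_mulC mulmxA.
by rewrite mulmxA.
Qed.

End Spectral.

(** * The optimal gain *)
Section Decay.
Variables (R : realType) (n m : nat).
Variables (A : 'M[R]_n) (B : 'M[R]_(n, m)) (Q : 'M[R]_n) (Rw : 'M[R]_m).
Hypotheses (hAB : stabilizable A B) (hQ : sym_posdef Q) (hR : sym_posdef Rw).

Local Notation G := (stabilizing A B).
Local Notation P := (lqr_P A B Q Rw).
Local Notation Pst := (opt_P A B Q Rw).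
Local Notation Kst := (opt_gain A B Q Rw).
Local Notation Yst := (opt_Y A B Q Rw).
Local Notation greedy := (greedy_gain B Rw).
Local Notation residual := (gain_residual A B Q Rw).
Local Notation cost := (stage_cost Q Rw).
Local Notation S := (B *m invmx Rw *m B^T).
Implicit Types K L : 'M[R]_(m, n).

(** Minimize Tr P_K over a compact sublevel set.  Replacing a minimizer K by the
    greedy gain L of P_K cannot increase P; as the trace is minimal, P_L = P_K,
    and completing the square at L turns the Lyapunov equation of P_L into the
    Riccati equation. *)
Lemma riccati_solvable : exists X, sym_posdef X /\ riccati A B Q Rw X = 0.
Proof.
have [K0 GK0] := hAB.
pose C := [set K | G K /\ \tr (P K) <= \tr (P K0)].
have [K] : exists2 K, K \in C & forall L, L \in C -> \tr (P K) <= \tr (P L).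
  apply: compact_EVT_min; first by exists K0; split.
    exact: sublevel_compact.
  apply: continuous_in_subspaceT => K /set_mem[GK _].
  exact: lqr_tr_continuous.
rewrite inE => -[GK KK0] minK; pose L := greedy (P K).
have ex x : excess A B Q Rw K L x <= 0 * qf (cost L) x.
  rewrite mul0r /excess subrr mul0mx qfx0 sub0r oppr_le0.
  by have [_] := posdef_psd hR; apply.
have GL : G L by apply: (stabilizing_of_excess _ _ GK ltr01 ex).
have := tr_of_excess hQ hR GK GL ex; rewrite subr0 mul1r => le_LK.
have PKL : P K - P L = 0.
  apply: psd_tr_eq0.
    apply: (psd_of_lyap GL); first by rewrite trmxDE trmxNE !lqr_P_sym.
    move=> x; rewrite lyapB qfB (qf_lyap_lqr_P hQ hR _ _ GK).
    rewrite (lqr_P_eqn Q Rw GL) qfN.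
    by have := ex x; lra.
  rewrite raddfB /=; apply/eqP; rewrite subr_eq0 eq_le le_LK andbT.
  by apply: minK; rewrite inE; split=> //; apply: le_trans KK0.
exists (P K); split; first exact: lqr_P_posdef.
have := complete_square A B Q hR L (lqr_P_sym hQ hR GK).
rewrite subrr mulmx0 addr0 => <-; move/eqP: PKL; rewrite subr_eq0 => /eqP ->.
by rewrite lqr_P_eqn // addNr.
Qed.

Lemma opt_P_spec : sym_posdef Pst /\ riccati A B Q Rw Pst = 0.
Proof.
have [X hX] := riccati_solvable.
by have := xgetPex 0 (ex_intro (fun X : 'M[R]_n => sym_posdef X /\ _ = 0) X hX).
Qed.

Lemma greedy_sq X : (greedy X)^T *m Rw *m greedy X = X^T *m S *m X.
Proof.
have [sR _] := hR.
by rewrite /greedy_gain; mxexpand; rewrite trmx_inv sR mulmxKV ?posdef_unit.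
Qed.

Lemma opt_gainE : Kst = greedy Pst. Proof. by []. Qed.

Lemma lyap_opt_P K :
  lyap (A - B *m K) Pst = - cost K + (K - Kst)^T *m Rw *m (K - Kst).
Proof.
have [[sP _] ric0] := opt_P_spec.
have := complete_square A B Q hR K sP; rewrite ric0 add0r -opt_gainE.
by move=> <-; rewrite [RHS]addrC addrK.
Qed.

Lemma stabilizing_opt : G Kst.
Proof.
have [dP _] := opt_P_spec; apply: Hurwitz_of_lyap dP _ => x x0.
rewrite lyap_opt_P subrr mulmx0 addr0 qfN oppr_lt0.
by have [_] := posdef_cost hQ hR Kst; apply.
Qed.

Lemma lqr_P_opt : P Kst = Pst.
Proof.
apply/esym/(lqr_P_uniq stabilizing_opt).
by rewrite lyap_opt_P subrr mulmx0 addr0.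
Qed.

Lemma opt_Y_spec : sym_posdef Yst /\ lyap (A - B *m Kst)^T Yst = - 1%:M.
Proof.
have hF := Hurwitz_tr stabilizing_opt.
have [Y hY] := lyap_surj (- 1%:M) hF.
have sY : Y^T = Y by apply: (lyap_sym hF _ hY); rewrite trmxNE trmx1.
have neg x : x != 0 -> qf (lyap (A - B *m Kst)^T Y) x < 0.
  by move=> x0; rewrite hY qfN oppr_lt0 qf1_gt0.
have dY : sym_posdef Y.
  apply: (psd_posdef_of_lyap _ neg); apply: (psd_of_lyap hF sY) => x.
  by rewrite hY qfN oppr_le0 qf1_ge0.
have hS : sym_posdef Y /\
    (A - B *m Kst) *m Y + Y *m (A - B *m Kst)^T + 1%:M = 0.
  by split=> //; move: hY; rewrite /lyap trmxK => ->; rewrite addNr.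
have [dYst eY] := xgetPex 0 (ex_intro (fun Y : 'M[R]_n => sym_posdef Y /\
    (A - B *m Kst) *m Y + Y *m (A - B *m Kst)^T + 1%:M = 0) Y hS).
split=> //; apply/eqP; rewrite /lyap trmxK -addr_eq0; exact/eqP.
Qed.

(** * Distance to the optimal gain *)
Definition weighted_ip K L : R := \tr (Yst *m (K^T *m Rw *m L)).
Local Notation wip := weighted_ip.
Local Notation wsq K := (wip K K).

Let sR : Rw^T = Rw. Proof. by case: hR. Qed.
Let sY : Yst^T = Yst. Proof. by case: opt_Y_spec => -[]. Qed.

Lemma wipC K L : wip K L = wip L K.
Proof.
rewrite /weighted_ip -mxtrace_tr !trmx_mul trmxK sR sY mxtrace_mulC.
by rewrite !mulmxA.
Qed.

Lemma wsqD K L : wsq (K + L) = wsq K + wip K L *+ 2 + wsq L.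
Proof.
have := wipC K L; rewrite /weighted_ip; mxexpand; rewrite !mxtraceD => <-; ring.
Qed.

Lemma wipDr K L1 L2 : wip K (L1 + L2) = wip K L1 + wip K L2.
Proof. by rewrite /weighted_ip !mulmxDr mxtraceD. Qed.

Lemma wipZr a K L : wip K (a *: L) = a * wip K L.
Proof. by rewrite /weighted_ip -!scalemxAr mxtraceZ. Qed.

Lemma wsqZ a K : wsq (a *: K) = a ^+ 2 * wsq K.
Proof. by rewrite wipZr wipC wipZr mulrA expr2. Qed.

Lemma wsq_ge0 K : 0 <= wsq K.
Proof.
apply: psd_tr_mul_ge0; first by apply: posdef_psd; case: opt_Y_spec.
exact/psd_congr/posdef_psd.
Qed.

Lemma wsq_gt0 K : K != 0 -> 0 < wsq K.
Proof.
move=> K0; have [dY _] := opt_Y_spec.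
have [y y0 hy] := posdef_coercive dY; have [r r0 hr] := posdef_coercive hR.
apply: (@lt_le_trans _ _ (y * (r * frob_norm K ^+ 2))).
  suff K1 : 0 < frob_norm K by rewrite !mulr_gt0 ?exprn_gt0.
  rewrite lt_neqAle frob_ge0 andbT eq_sym.
  by apply: contra K0 => /eqP/frob_eq0 ->.
have h1 : r * frob_norm K ^+ 2 <= \tr (K^T *m Rw *m K).
  rewrite frob_sqr -mxtraceZ; apply: psd_tr_le.
  have -> : K^T *m Rw *m K - r *: (K^T *m K) = K^T *m (Rw - r *: 1%:M) *m K.
    by mxexpand; rewrite mulmx1.
  apply: psd_congr; split; first by rewrite trmxDE trmxNE trmxZE trmx1 sR.
  by move=> x; rewrite qfB qfZ subr_ge0.
apply: le_trans (_ : y * \tr (K^T *m Rw *m K) <= _).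
  by rewrite ler_wpM2l ?(ltW y0).
rewrite -mxtraceZ -[y *: _]mul1mx -scalemxAr scalemxAl.
apply: psd_tr_mul_le; last exact/psd_congr/posdef_psd.
split; first by rewrite trmxDE trmxNE trmxZE trmx1 sY.
by move=> x; rewrite qfB qfZ subr_ge0.
Qed.

Lemma wip_le_frob K L :
  `|wip K L| <= frob_norm Yst * frob_norm Rw * (frob_norm K * frob_norm L).
Proof.
rewrite /weighted_ip -{1}sY; apply: le_trans (frob_CS _ _) _.
rewrite -mulrA ler_wpM2l ?frob_ge0 // (le_trans (frobM _ _)) // mulrA.
rewrite ler_wpM2r ?frob_ge0 // (le_trans (frobM _ _)) //.
by rewrite frob_tr mulrC.
Qed.

Lemma psd_gap K : G K -> psd (P K - Pst).
Proof.
move=> GK; have [[sP _] _] := opt_P_spec.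
apply: (psd_of_lyap GK); first by rewrite trmxDE trmxNE sP lqr_P_sym.
move=> x; rewrite lyapB lyap_opt_P (lqr_P_eqn _ _ GK) qfB qfD qf_congr.
by have [_ /(_ ((K - Kst) *m x))] := posdef_psd hR; lra.
Qed.

Definition gap K : R := \tr (P K) - \tr Pst.

Lemma gapE K : gap K = \tr (P K - Pst).
Proof. by rewrite raddfB. Qed.

Lemma gap_ge0 K : G K -> 0 <= gap K.
Proof. by move=> GK; rewrite gapE; apply/psd_tr_ge0/psd_gap. Qed.

(** [K - Kst - residual K] is the greedy gain of P_K - Pst.  The identity is the
    Lyapunov equation of P_K - Pst along the optimal closed loop, paired with
    Yst. *)
Lemma gap_residual K : G K ->
  gap K = wsq (residual K) - wsq (K - Kst - residual K).
Proof.
move=> GK; have [_ eY] := opt_Y_spec.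
have : \tr (Yst *m lyap (A - B *m Kst) (P K - Pst)) = - gap K.
  by rewrite tr_lyap_dual eY mulNmx mul1mx raddfN gapE.
move=> /(congr1 (fun u => - u)); rewrite opprK => <-.
rewrite lyapB lyap_lqr_P // lyap_opt_P subrr mulmx0 addr0.
rewrite [- cost _ + _]addrC addrK.
have -> : wsq (K - Kst - residual K) = wsq (Kst - greedy (P K)).
  have -> : K - Kst - residual K = (-1) *: (Kst - greedy (P K)).
    by rewrite /gain_residual; mxring.
  by rewrite wsqZ sqrrN expr1n mul1r.
by rewrite mulmxBr raddfB /= opprB.
Qed.

(** Strong monotonicity of the residual about the optimal gain; this is what
    makes the distance contract. *)
Lemma inner_residual K : G K ->
  wip (K - Kst) (residual K) *+ 2 = wsq (K - Kst) + gap K.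
Proof.
move=> GK; rewrite gap_residual // -[- residual K]scaleN1r; set E := K - Kst.
by rewrite wsqD wsqZ wipZr; ring.
Qed.

(** With X = P_K - Pst, the square missing in [gap_residual] is
    Tr (Yst X S X), S = B R^-1 B^T, at most
    |Yst| |S| (Tr X)^2 <= |Yst| |S| Tr P_K gap: this is where the constant c(K)
    comes from. *)
Lemma residual_le_gap K : G K ->
  wsq (residual K) <= lqr_c A B Q Rw K * gap K.
Proof.
move=> GK; have := gap_residual GK.
suff : wsq (K - Kst - residual K) <=
    spectral_norm Yst * spectral_norm S * \tr (P K) * gap K.
  by rewrite /lqr_c mulrDl mul1r; lra.
have pX := psd_gap GK; set X := P K - Pst in pX.
have [sX _] := pX.
have E'E : K - Kst - residual K = greedy X.
  rewrite /gain_residual opt_gainE /X /greedy_gain; mxexpand; mxring.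
have pS : psd S.
  rewrite -{1}[B]trmxK; apply: psd_congr; exact: psd_inv.
have [sS _] := pS.
rewrite E'E /weighted_ip greedy_sq.
have pXSX := psd_congr X pS.
apply: le_trans (psd_tr_mul_le (psd_spectral sY) pXSX) _.
rewrite -scalemxAl mul1mx mxtraceZ -!mulrA ler_wpM2l ?spectral_ge0 //.
have -> : \tr (X^T *m S *m X) = \tr (S *m (X *m X^T)).
  by rewrite mxtrace_mulC [RHS]mxtrace_mulC !mulmxA.
have pXX : psd (X *m X^T).
  by have := psd_congr X^T (psd1 R n); rewrite trmxK mulmx1.
apply: le_trans (psd_tr_mul_le (psd_spectral sS) pXX) _.
rewrite -scalemxAl mul1mx mxtraceZ ler_wpM2l ?spectral_ge0 //.
rewrite mxtrace_mulC -frob_sqr.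
apply: le_trans (_ : \tr X ^+ 2 <= _).
  by rewrite lerXn2r ?nnegrE ?frob_ge0 ?psd_tr_ge0 ?psd_frob_le_tr.
rewrite -gapE expr2 ler_wpM2r ?gap_ge0 // /gap lerBlDr lerDl.
by apply/psd_tr_ge0/posdef_psd; case: opt_P_spec.
Qed.

Lemma lqr_c_ge1 K : G K -> 1 <= lqr_c A B Q Rw K.
Proof.
by move=> GK; rewrite /lqr_c lerDl !mulr_ge0 ?spectral_ge0 ?lqr_tr_ge0.
Qed.

Lemma distance_step K W eta : G K -> 0 <= eta <= 1 ->
  eta * (4 * lqr_c A B Q Rw K) <= 1 ->
  wsq (K - eta *: (residual K + W) - Kst) <=
    wsq (K - Kst) - eta / 2 * (wsq (K - Kst) + gap K) + 4 * eta * wsq W.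
Proof.
move=> GK /andP[eta0 eta1] etac.
have -> : K - eta *: (residual K + W) - Kst =
    (K - Kst) + (- eta) *: (residual K + W) by mxexpand; mxring.
have h1 := inner_residual GK; have h2 := residual_le_gap GK.
set E := K - Kst in h1 *; set M := residual K in h1 h2 *.
have V0 := gap_ge0 GK; have W0 := wsq_ge0 W.
rewrite wsqD wsqZ wipZr wipDr wsqD.
have h3 : 0 <= wsq (E + 2 *: W) by apply: wsq_ge0.
have h4 : 0 <= wsq (M + (-1) *: W) by apply: wsq_ge0.
rewrite wsqD wsqZ wipZr in h3; rewrite wsqD wsqZ wipZr in h4.
have h5 : eta * (wsq M * 4) <= gap K.
  apply: le_trans (_ : eta * (4 * lqr_c A B Q Rw K) * gap K <= _).
    by rewrite -mulrA ler_wpM2l // [wsq M * 4]mulrC -mulrA ler_wpM2l.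
  by rewrite ler_piMl.
have h6 : eta * (eta * (wsq M * 4)) <= eta * gap K by rewrite ler_wpM2l.
have h7 : eta ^+ 2 * (wsq M + wip M W *+ 2 + wsq W) <=
    eta ^+ 2 * (2 * wsq M + 2 * wsq W).
  by rewrite ler_wpM2l ?sqr_ge0 //; lra.
have h8 : eta * (eta * wsq W) <= eta * wsq W.
  by rewrite ler_wpM2l // ler_piMl.
have h9 : eta * (- (2 * wip E W)) <= eta * (wsq E / 2 + 2 * wsq W).
  by rewrite ler_wpM2l //; lra.
have h10 : eta * (wip E M *+ 2) = eta * (wsq E + gap K) by rewrite h1.
lra.
Qed.

(** * The size function and one disturbed step *)

(** The distance contracts but stays bounded near the frontier; the logarithm
    diverges there, and changes by a bounded amount under a disturbance because
    Tr P changes by a bounded factor. *)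
Definition lqr_size K : R :=
  wsq (K - Kst) + (ln (1 + \tr (P K)) - ln (1 + \tr Pst)).

Lemma tr_opt_P_ge0 : 0 <= \tr Pst.
Proof. by rewrite -lqr_P_opt; apply/(lqr_tr_ge0 hQ hR)/stabilizing_opt. Qed.

Lemma log_gap_le K : G K -> ln (1 + \tr (P K)) - ln (1 + \tr Pst) <= gap K.
Proof.
move=> GK; have t0 := tr_opt_P_ge0; have s0 := lqr_tr_ge0 hQ hR GK.
have v0 := gap_ge0 GK.
rewrite -ln_div ?posrE; try lra.
have -> : (1 + \tr (P K)) / (1 + \tr Pst) = 1 + gap K / (1 + \tr Pst).
  by rewrite /gap; field; lra.
apply: le_trans (_ : gap K / (1 + \tr Pst) <= _).
  apply: le_ln1Dx; apply: (@lt_le_trans _ _ 0); first by lra.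
  by rewrite divr_ge0 //; lra.
by rewrite ler_pdivrMr ?ler_peMr //; lra.
Qed.

Lemma log_gap_ge0 K : G K -> 0 <= ln (1 + \tr (P K)) - ln (1 + \tr Pst).
Proof.
move=> GK; have := gap_ge0 GK; have := tr_opt_P_ge0; rewrite /gap => t0 g0.
by rewrite subr_ge0 ler_ln ?posrE; lra.
Qed.

Lemma size_ge0 K : G K -> 0 <= lqr_size K.
Proof. by move=> GK; rewrite addr_ge0 ?wsq_ge0 ?log_gap_ge0. Qed.

Lemma size_opt : lqr_size Kst = 0.
Proof.
by rewrite /lqr_size lqr_P_opt !subrr /weighted_ip !mulmx0 mxtrace0 addr0.
Qed.

Lemma size_gt0 K : G K -> K != Kst -> 0 < lqr_size K.
Proof.
by move=> GK KK; rewrite ltr_wpDr ?log_gap_ge0 // wsq_gt0 // subr_eq0.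
Qed.

Lemma tr_le_of_size K r : G K -> lqr_size K <= r ->
  \tr (P K) <= expR (r + ln (1 + \tr Pst)).
Proof.
move=> GK Kr; have s0 := lqr_tr_ge0 hQ hR GK.
have h : ln (1 + \tr (P K)) <= r + ln (1 + \tr Pst).
  by move: Kr; have := wsq_ge0 (K - Kst); rewrite /lqr_size; lra.
have : 1 + \tr (P K) <= expR (r + ln (1 + \tr Pst)).
  by rewrite -[X in X <= _]lnK ?posrE ?ler_expR //; lra.
lra.
Qed.

(** The new gain differs from the greedy gain by (1 - eta) M + eta (- W), so
    this is convexity of the square. *)
Lemma excess_step K W eta x : 0 <= eta <= 1 ->
  excess A B Q Rw K (K - eta *: (residual K + W)) x <= eta * qf Rw (W *m x).
Proof.
move=> /andP[eta0 eta1]; have pR := posdef_psd hR; have [_ R0] := pR.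
rewrite /excess.
have -> : (K - eta *: (residual K + W) - greedy (P K)) *m x =
    (1 - eta) *: (residual K *m x) + (- eta) *: (W *m x).
  rewrite /gain_residual !scalemxAl -mulmxDl; congr (_ *m x); mxexpand; mxring.
set a := residual K *m x; set b := W *m x.
rewrite (qf_line _ _ _ sR).
rewrite qfxZ bilinZl.
have := R0 (a + 1 *: b); rewrite (qf_line _ _ _ sR) => h.
have h1 : 0 <= (1 - eta) * eta * (qf Rw a + 1 * (a^T *m Rw *m b) 0 0 *+ 2
   + 1 ^+ 2 * qf Rw b) by rewrite !mulr_ge0 ?subr_ge0.
have h2 : 0 <= eta * qf Rw a by rewrite mulr_ge0.
lra.
Qed.

(** The logarithm can grow by 2 eta e at most, e being the size of W^T R W
    relative to Q; the multiple eta / 2 of the gap which the distance loses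
    dominates eta / 2 times the logarithm. *)
Lemma disturbed_step : exists C d, [/\ 0 < C, 0 < d &
  forall K W eta w, G K -> frob_norm W <= w -> w < d ->
    0 < eta -> eta <= Num.min 1 (1 / (4 * lqr_c A B Q Rw K)) ->
    let L := K - eta *: (residual K + W) in
    G L /\ lqr_size L <= (1 - eta / 2) * lqr_size K + eta * C * w ^+ 2].
Proof.
have [q q0 hq] := posdef_coercive hQ.
pose k1 := frob_norm Rw / q; pose k2 := frob_norm Yst * frob_norm Rw.
have k10 : 0 <= k1 by rewrite divr_ge0 ?frob_ge0 ?(ltW q0).
have k20 : 0 <= k2 by rewrite mulr_ge0 ?frob_ge0.
(* 4 k2 comes from the distance, 2 k1 from the logarithm; the bound on d
   ensures k1 w^2 <= 1 / 2. *)
pose C := 4 * k2 + 2 * k1 + 1; pose d := Num.min 1 (2 * k1 + 1)^-1.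
have d1 : 0 < 2 * k1 + 1 by lra.
exists C, d; split; [by rewrite /C; lra|by rewrite lt_min ltr01 invr_gt0|].
move=> K W eta w GK Ww wd eta0; rewrite le_min => /andP[eta1 etac].
have c1 := lqr_c_ge1 GK.
have {}etac : eta * (4 * lqr_c A B Q Rw K) <= 1.
  by rewrite -ler_pdivlMr //; lra.
have eta01 : 0 <= eta <= 1 by rewrite ltW.
set L := _ - _ => /=.
have w0 : 0 <= w := le_trans (frob_ge0 _) Ww.
pose e := k1 * w ^+ 2.
have e0 : 0 <= e by rewrite mulr_ge0 ?sqr_ge0.
have e2 : e <= 2^-1.
  have : w ^+ 2 <= (2 * k1 + 1)^-1.
    apply: le_trans (_ : w <= _).
      by rewrite expr2 ler_piMl // (le_trans (ltW wd)) // ge_min lexx.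
    by apply: le_trans (ltW wd) _; rewrite ge_min lexx orbT.
  rewrite -[(_)^-1]div1r ler_pdivlMr // => h; rewrite /e.
  by have := sqr_ge0 w; lra.
have W2 : frob_norm W ^+ 2 <= w ^+ 2 by rewrite lerXn2r ?nnegrE ?frob_ge0.
have ee : eta * e <= e by rewrite ler_piMl.
have ee0 : 0 <= eta * e by rewrite mulr_ge0 // ltW.
have ex x : excess A B Q Rw K L x <= eta * e * qf (cost L) x.
  apply: le_trans (excess_step K W x eta01) _.
  rewrite -mulrA ler_wpM2l ?(ltW eta0) //.
  apply: le_trans (_ : e * qf Q x <= _); last first.
    rewrite ler_wpM2l // qf_cost lerDl; by have [_] := posdef_psd hR; apply.
  apply: le_trans (le_trans (ler_norm _) (qf_le_frob _ _)) _.
  apply: le_trans (_ : frob_norm Rw * (w ^+ 2 * qf 1%:M x) <= _).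
    rewrite ler_wpM2l ?frob_ge0 // (le_trans (frob_qf_mul _ _)) //.
    by rewrite ler_wpM2r ?qf1_ge0.
  have -> : e * qf Q x = frob_norm Rw * (w ^+ 2 * (q^-1 * qf Q x)).
    by rewrite /e /k1; ring.
  by rewrite !ler_wpM2l ?frob_ge0 ?sqr_ge0 // ler_pdivlMl.
have e1 : eta * e < 1 by lra.
have GL : G L by apply: (stabilizing_of_excess hQ hR GK e1 ex).
split=> //.
have tLK := tr_of_excess hQ hR GK GL ex.
have tL := lqr_tr_ge0 hQ hR GL; have tK := lqr_tr_ge0 hQ hR GK.
have lnLK : ln (1 + \tr (P L)) <= ln (1 + \tr (P K)) + 2 * (eta * e).
  apply: le_trans (_ : ln ((1 + 2 * (eta * e)) * (1 + \tr (P K))) <= _).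
    rewrite ler_ln ?posrE; try by rewrite ?mulr_gt0 //; lra.
    have : (1 + 2 * (eta * e)) * ((1 - eta * e) * \tr (P L)) <=
        (1 + 2 * (eta * e)) * \tr (P K) by rewrite ler_wpM2l //; lra.
    have : 0 <= (eta * e) * (1 - 2 * (eta * e)) * \tr (P L).
      by rewrite mulr_ge0 // mulr_ge0 //; lra.
    lra.
  rewrite lnM ?posrE; try lra.
  by rewrite addrC lerD2l le_ln1Dx //; lra.
have := distance_step W GK eta01 etac; rewrite -/L => dist.
have wW : wsq W <= k2 * w ^+ 2.
  apply: le_trans (le_trans (ler_norm _) (wip_le_frob W W)) _.
  by rewrite -expr2 ler_wpM2l.
have h1 : eta * wsq W <= eta * (k2 * w ^+ 2) by rewrite ler_wpM2l // ltW.
have h2 : eta * (ln (1 + \tr (P K)) - ln (1 + \tr Pst)) <= eta * gap K.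
  by rewrite ler_wpM2l ?log_gap_le // ltW.
have h3 : 0 <= eta * w ^+ 2 by rewrite mulr_ge0 ?sqr_ge0 // ltW.
rewrite /lqr_size; rewrite /e in lnLK; rewrite /C.
lra.
Qed.

End Decay.

(** * A KL function from countably many rates *)
Section KL.
Variable R : realType.

Section Envelope.
Variable sigma : nat -> nat -> R.
Hypothesis sigma_gt0 : forall i k, 0 < sigma i k.
Hypothesis sigma_dec : forall i k l, (k <= l)%N -> sigma i l <= sigma i k.
Hypothesis sigma_cvg : forall i, sigma i k @[k --> \oo] --> 0.

(** Equal to 1 for i <= r + 1 and to 0 for i >= r + 2: at r only finitely many
    rates are active, among them that of an integer i between r and r + 1. *)
Definition ramp (i : nat) (r : R) : R := Num.min 1 (Num.max 0 (r - i%:R + 2)).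

Lemma ramp_ge0 i r : 0 <= ramp i r.
Proof. by rewrite le_min ler01 le_max lexx. Qed.

Lemma ramp_le i r s : r <= s -> ramp i r <= ramp i s.
Proof.
move=> rs; rewrite /ramp le_min ge_min lexx /= ge_min ge_max !le_max lexx /=.
by rewrite lerD2r lerD2r rs !orbT.
Qed.

Lemma ramp_eq0 i r : r + 2 <= i%:R -> ramp i r = 0.
Proof. by move=> h; rewrite /ramp max_l ?min_r //; lra. Qed.

Lemma ramp_eq1 i r : i%:R <= r + 1 -> ramp i r = 1.
Proof. by move=> h; rewrite /ramp max_r ?min_l //; lra. Qed.

Lemma ramp_continuous i : continuous (ramp i).
Proof.
move=> r.
apply: (@continuous_min R R (fun=> 1) (fun u => Num.max 0 (u - i%:R + 2)) r).
  exact: cst_continuous.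
apply: (@continuous_max R R (fun=> 0) (fun u => u - i%:R + 2) r).
  exact: cst_continuous.
apply: (@continuousD R R R (fun u => u - i%:R)); last exact: cst_continuous.
by apply: (@continuousB R R R id (fun=> i%:R)) => //; exact: cst_continuous.
Qed.

Definition envelope (N k : nat) (r : R) : R :=
  r * \sum_(0 <= i < N) ramp i r * sigma i k.

Lemma envelope_widen N M k r : (N <= M)%N -> r + 2 <= N%:R ->
  envelope M k r = envelope N k r.
Proof.
move=> NM rN; rewrite /envelope (@big_cat_nat _ _ _ N) //=.
rewrite [X in _ + X]big_nat [X in _ + X]big1 ?addr0 // => i /andP[Ni _].
by rewrite ramp_eq0 ?mul0r // (le_trans rN) // ler_nat.
Qed.

Lemma envelope_continuous N k : continuous (envelope N k).
Proof.
have cS : continuous (fun r => \sum_(0 <= i < N) ramp i r * sigma i k).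
  elim: N => [|N IH].
    rewrite (_ : (fun _ => _) = fun=> 0); first exact: cst_continuous.
    by apply/funext => x; rewrite big_nil.
  rewrite (_ : (fun _ => _) = fun r =>
      \sum_(0 <= i < N) ramp i r * sigma i k + ramp N r * sigma N k);
    last first.
    by apply/funext => x; rewrite big_nat_recr.
  move=> r; apply: (@continuousD R R R
    (fun r => \sum_(0 <= i < N) ramp i r * sigma i k)
    (fun r => ramp N r * sigma N k)); first exact: IH.
  by apply: (@continuousM R R (ramp N) (fun=> sigma N k));
    [exact: ramp_continuous|exact: cst_continuous].
move=> r; apply: (@continuousM R R id
  (fun r => \sum_(0 <= i < N) ramp i r * sigma i k)) => //; exact: cS.
Qed.

Lemma envelope_lt N k r s : 0 <= r -> r < s -> (0 < N)%N ->
  envelope N k r < envelope N k s.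
Proof.
move=> r0 rs N0; have s0 : 0 < s by exact: le_lt_trans rs.
apply: (@le_lt_trans _ _ (r * \sum_(0 <= i < N) ramp i s * sigma i k)).
  rewrite ler_wpM2l // ler_sum // => i _.
  by rewrite ler_wpM2r ?(ltW (sigma_gt0 _ _)) // ramp_le // ltW.
rewrite ltr_pM2r //; case: N N0 => // N _; rewrite big_nat_recl //.
rewrite ltr_wpDr //; last first.
  by rewrite ramp_eq1 ?mul1r //; lra.
by apply: sumr_ge0 => i _; rewrite mulr_ge0 ?ramp_ge0 ?(ltW (sigma_gt0 _ _)).
Qed.

(** Summing all active rates, rather than choosing one, gives continuity and
    strict monotonicity in r although the rates for different i are
    unrelated. *)
Definition beta (r t : R) : R := envelope (Num.truncn r).+3 (Num.truncn t) r.

(** Locally in r the number of terms can be fixed. *)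
Lemma betaE N r t : 0 <= r -> r + 2 <= N%:R ->
  beta r t = envelope N (Num.truncn t) r.
Proof.
move=> r0 rN; pose M := maxn N (Num.truncn r).+3; rewrite /beta.
rewrite -(@envelope_widen N M) ?leq_maxl // -(@envelope_widen _ M) ?leq_maxr //.
have := truncnS_gt r; rewrite -[_.+3]addn2 natrD; lra.
Qed.

Lemma beta0 t : beta 0 t = 0.
Proof. by rewrite /beta /envelope mul0r. Qed.

Lemma beta_lt r s t : 0 <= r -> r < s -> beta r t < beta s t.
Proof.
move=> r0 rs; have s0 : 0 <= s by lra.
have hs : s + 2 <= (Num.truncn s).+3%:R.
  have := truncnS_gt s; rewrite -[_.+3]addn2 natrD; lra.
rewrite (betaE t s0 hs) (betaE t r0 (N := (Num.truncn s).+3)); last by lra.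
exact: envelope_lt.
Qed.

Lemma beta_continuous t : {within [set r : R | 0 <= r /\ (r%:E < +oo)%E],
  continuous (beta ^~ t)}.
Proof.
apply/subspace_continuousP => r [r0 _]; pose N := (Num.truncn r).+4.
have hN x : x < r + 1 -> x + 2 <= N%:R.
  have := truncnS_gt r; rewrite /N -[_.+4]addn3 natrD; lra.
change (beta x t @[x --> within [set r : R | 0 <= r /\ (r%:E < +oo)%E] (nbhs r)]
  --> beta r t).
rewrite (@betaE N) ?hN //; last by lra.
apply: (@cvg_trans _ (envelope N (Num.truncn t) x @[x --> within
    [set r : R | 0 <= r /\ (r%:E < +oo)%E] (nbhs r)])).
  apply: near_eq_cvg; rewrite near_withinE; apply/nbhs_ballP.
  exists 1 => //= x; rewrite /ball /= ltr_norml => /andP[h1 _] [x0 _].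
  by rewrite (@betaE N) // hN //; lra.
by apply: cvg_within_filter; exact: envelope_continuous.
Qed.

Lemma beta_dec r s t : 0 <= r -> 0 <= s -> s <= t -> beta r t <= beta r s.
Proof.
move=> r0 s0 st; rewrite /beta /envelope ler_wpM2l // ler_sum // => i _.
by rewrite ler_wpM2l ?ramp_ge0 // sigma_dec // le_truncn.
Qed.

Lemma beta_cvg r : 0 <= r -> beta r t @[t --> +oo] --> 0.
Proof.
move=> r0; pose N := (Num.truncn r).+3.
have cS M : (\sum_(0 <= i < M) ramp i r * sigma i k) @[k --> \oo] --> (0 : R).
  elim: M => [|M IH].
    rewrite (_ : (fun _ => _) = fun=> 0); first exact: cvg_cst.
    by apply/funext => x; rewrite big_nil.
  rewrite (_ : (fun _ => _) = fun k =>
      \sum_(0 <= i < M) ramp i r * sigma i k + ramp M r * sigma M k);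
    last first.
    by apply/funext => x; rewrite big_nat_recr.
  have h : ramp M r * sigma M k @[k --> \oo] --> (0 : R).
    by have := cvgM (cvg_cst (ramp M r)) (@sigma_cvg M); rewrite mulr0; apply.
  by have := cvgD IH h; rewrite addr0; apply.
have cN : envelope N k r @[k --> \oo] --> (0 : R).
  by have := cvgM (cvg_cst r) (cS N); rewrite mulr0; apply.
apply/cvgrPdist_le => e e0; move/cvgrPdist_le/(_ e e0): cN => [K _ hK].
near=> t; apply: hK => /=.
rewrite truncn_ge_nat.
  by near: t; apply: nbhs_pinfty_ge; rewrite num_real.
by near: t; apply: nbhs_pinfty_ge; rewrite num_real.
Unshelve. all: by end_near. Qed.

Lemma beta_classKL : classKL beta.
Proof.
split=> [t _|r r0]; last first.
  by split; [move=> s t; apply: beta_dec|apply: beta_cvg].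
split; [exact: beta_continuous| |exact: beta0].
by move=> r s /set_mem[r0 _] _; apply: beta_lt.
Qed.

Lemma beta_ge i k r : 0 <= r -> r <= i%:R -> i%:R <= r + 1 ->
  r * sigma i k <= beta r k%:R.
Proof.
move=> r0 ri ir; rewrite (@betaE i.+3) //; last first.
  by rewrite -[_.+3]addn2 natrD -[i.+1]addn1 natrD; lra.
rewrite natrK /envelope ler_wpM2l //.
rewrite (bigD1_seq i) ?iota_uniq //=; last first.
  by rewrite mem_index_iota /= ltnS -addn2 leq_addr.
rewrite ramp_eq1 // mul1r lerDl sumr_ge0 // => j _.
by rewrite mulr_ge0 ?ramp_ge0 // ltW.
Qed.

End Envelope.
End KL.

Section Rate.
Variable R : realType.

Definition decay_rate (e : nat -> R) (k : nat) : R :=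
  expR (- (\sum_(0 <= j < k) Num.max 0 (e j)) / 2).

Lemma decay_rate_gt0 e k : 0 < decay_rate e k.
Proof. exact: expR_gt0. Qed.

Lemma decay_rate_dec e k l : (k <= l)%N -> decay_rate e l <= decay_rate e k.
Proof.
move=> kl; rewrite ler_expR ler_pM2r ?invr_gt0 // lerN2.
rewrite [X in _ <= X](@big_cat_nat _ _ _ k) //=.
by rewrite lerDl sumr_ge0 // => j _; rewrite le_max lexx.
Qed.

Lemma decay_rate_cvg e : (\sum_(0 <= j < N) e j) @[N --> \oo] --> +oo ->
  decay_rate e k @[k --> \oo] --> 0.
Proof.
move=> he; apply/cvgrPdist_le => d d0.
move/cvgryPge/(_ (- (2 * ln d))) : he => [K _ hK]; exists K => // k /hK /= h.
rewrite sub0r normrN gtr0_norm ?decay_rate_gt0 // -[d]lnK ?posrE // ler_expR.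
have : \sum_(0 <= j < k) e j <= \sum_(0 <= j < k) Num.max 0 (e j).
  by apply: ler_sum => j _; rewrite le_max lexx orbT.
lra.
Qed.

(** From 1 - x <= exp (- x). *)
Lemma decay_rateS e k eta : e k <= eta -> 0 <= eta ->
  (1 - eta / 2) * decay_rate e k <= decay_rate e k.+1.
Proof.
move=> ek eta0; rewrite /decay_rate big_nat_recr //=.
rewrite opprD [X in _ <= expR X]mulrDl expRD mulrC ler_wpM2l ?expR_ge0 //.
apply: le_trans (_ : expR (- eta / 2) <= _).
  by apply: le_trans (expR_ge1Dx _); lra.
by rewrite ler_expR ler_pM2r ?invr_gt0 // lerN2 ge_max eta0 ek.
Qed.

End Rate.

(** * Input-to-state stability *)
Section Main.
Variables (R : realType) (n m : nat).
Variables (A : 'M[R]_n) (B : 'M[R]_(n, m)) (Q : 'M[R]_n) (Rw : 'M[R]_m).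
Hypotheses (hAB : stabilizable A B) (hQ : sym_posdef Q) (hR : sym_posdef Rw).

Local Notation G := (stabilizing A B).
Local Notation Kst := (opt_gain A B Q Rw).
Local Notation Yst := (opt_Y A B Q Rw).
Local Notation wip := (weighted_ip A B Q Rw).
Local Notation lsize := (lqr_size A B Q Rw).

Lemma wsq_continuous :
  continuous (fun K : 'M[R]_(m, n) => wip (K - Kst) (K - Kst)).
Proof.
move=> K; apply: (proj2 (@cvgrPdist_le _ _ _ (nbhs K) (nbhs_filter K) _ _)).
move=> e e0; apply/frob_nbhsP.
set c := frob_norm Yst * frob_norm Rw.
have c0 : 0 <= c by rewrite mulr_ge0 ?frob_ge0.
set E := K - Kst; have E0 := frob_ge0 E.
pose f := c * (2 * frob_norm E + 1) + 1.
have f0 : 0 < f by rewrite ltr_wpDl // mulr_ge0 //; lra.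
exists (Num.min 1 (e / f)); first by rewrite lt_min ltr01 divr_gt0.
move=> L; rewrite lt_min => /andP[D1 De]; set D := L - K in D1 De.
have D0 := frob_ge0 D.
have -> : L - Kst = E + D by rewrite /E /D addrC -addrA addrCA subrKC.
rewrite /= -/E [wip (E + D) _]wsqD //.
have -> : wip E E - (wip E E + wip E D *+ 2 + wip D D) =
    - (wip E D *+ 2 + wip D D) by ring.
rewrite normrN.
have h1 := wip_le_frob hAB hQ hR E D.
have h2 := wip_le_frob hAB hQ hR D D; rewrite -/c in h1 h2.
apply: le_trans (ler_normD _ _) _; rewrite normrMn.
have h3 : c * (frob_norm D * frob_norm D) <= c * frob_norm D.
  by rewrite ler_wpM2l // ler_piMl // ltW.
have : frob_norm D * f <= e by rewrite -ler_pdivlMr // ltW.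
rewrite /f; lra.
Qed.

Lemma size_continuous : {within G, continuous lsize}.
Proof.
apply: continuous_in_subspaceT => K /set_mem GK.
apply: (@continuousD R R _ (fun K : 'M[R]_(m, n) => wip (K - Kst) (K - Kst))).
  exact: wsq_continuous.
apply: (@continuousB R R _
   (fun K : 'M[R]_(m, n) => ln (1 + \tr (lqr_P A B Q Rw K)))
   (fun=> ln (1 + \tr (opt_P A B Q Rw)))); last exact: cst_continuous.
apply: (@continuous_comp _ _ _
  (fun K : 'M[R]_(m, n) => 1 + \tr (lqr_P A B Q Rw K)) (@ln R)).
  apply: (@continuousD R R _ (fun=> 1)); first exact: cst_continuous.
  exact: lqr_tr_continuous.
by apply: continuous_ln; have := lqr_tr_ge0 hQ hR GK; lra.
Qed.

(** Where the size is at most a, Tr P_K is bounded; [gain_bound] then bounds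
    the gain, and [sublevel_margin] keeps it away from the frontier. *)
Lemma size_coercive Ks : (forall k, G (Ks k)) ->
  tends_to_frontier G Ks \/ frob_norm (Ks k) @[k --> \oo] --> +oo ->
  lsize (Ks k) @[k --> \oo] --> +oo.
Proof.
move=> GK h; apply/cvgryPge => a.
pose r := expR (a + ln (1 + \tr (opt_P A B Q Rw))).
have tr_le k : ~~ (a <= lsize (Ks k)) -> \tr (lqr_P A B Q Rw (Ks k)) <= r.
  by rewrite -ltNge => /ltW; apply: tr_le_of_size.
case: h => [hf|hn].
  have [d d0 hd] := sublevel_margin A B hQ hR r (half01 R).
  move: (hf d d0) => [N _ hN]; exists N => // k /hN /= [L [_ nL] KL].
  apply: contraT => /tr_le Kr; exfalso; apply: nL.
  have : frob_norm (L - Ks k) <= d by rewrite -frobN opprB ltW.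
  move=> /(hd _ _ (GK k) Kr)[GL _ _].
  have oG : open G := @stabilizing_open _ _ _ A B _ _ hQ hR.
  by rewrite (proj1 (interior_id G) oG).
have [b hb] := gain_bound A B hQ hR r.
move/cvgryPgt/(_ b): hn => [N _ hN]; exists N => // k /hN /= lt_b.
apply: contraT => /tr_le Kr; move: lt_b; rewrite ltNge.
by rewrite (hb _ (GK k) Kr).
Qed.

Lemma size_is_size_function : size_function G Kst lsize.
Proof.
split.
- by move=> K; apply: size_ge0.
- exact: size_continuous.
- exact: size_opt.
- by move=> K; apply: size_gt0.
- exact: size_coercive.
Qed.

Lemma linf_norm_ge (W : nat -> 'M[R]_(m, n)) k : bounded_signal W ->
  frob_norm (W k) <= linf_norm W.
Proof. by move=> bW; apply: ub_le_sup => //; exists k. Qed.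

End Main.

Theorem theorem36 (R : realType) (n m : nat)
    (A : 'M[R]_n) (B : 'M[R]_(n, m)) (Q : 'M[R]_n) (Rw : 'M[R]_m)
    (hAB : stabilizable A B) (hQ : sym_posdef Q) (hR : sym_posdef Rw)
    (lo : nat -> 'M[R]_(m, n) -> R)
    (hlo : nonsummable_steps (stabilizing A B) lo) :
  small_disturbance_ISS (stabilizing A B) (opt_gain A B Q Rw)
    (fun k K W K1 => gauss_newton_step A B Q Rw (lo k K) K W K1).
Proof.
have [C [d [C0 d0 step]]] := disturbed_step hAB hQ hR.
pose r i := expR (i%:R + 1 + ln (1 + \tr (opt_P A B Q Rw))).
have /boolp.choice[e he] i : exists e : nat -> R,
    (forall k K, stabilizing A B K -> \tr (lqr_P A B Q Rw K) <= r i ->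
      e k <= lo k K) /\
    (\sum_(0 <= k < N) e k) @[N --> \oo] --> +oo.
  pose D := [set K | stabilizing A B K /\ \tr (lqr_P A B Q Rw K) <= r i].
  have cD : compact D by exact: sublevel_compact.
  have [e [he1 he2]] : exists e : nat -> R,
      (forall k K, D K -> e k <= lo k K) /\
      (\sum_(0 <= k < N) e k) @[N --> \oo] --> +oo.
    by apply: hlo cD _ => K [].
  by exists e; split=> // k K GK Kr; apply: he1.
pose sigma i := decay_rate (e i).
(* With w^2 <= w < 1 / (2 C) the run stays in the sublevel set of U(0) + 1. *)
pose d' := Num.min d (Num.min 1 (2 * C)^-1).
have C2 : 0 < 2 * C by lra.
exists (lqr_size A B Q Rw), d'%:E, (beta sigma), (fun s => 2 * C * s ^+ 2).
split.
- exact: size_is_size_function.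
- by rewrite lte_fin !lt_min d0 ltr01 invr_gt0.
- apply: beta_classKL.
  + by move=> i k; apply: decay_rate_gt0.
  + by move=> i k l; apply: decay_rate_dec.
  + by move=> i; apply: decay_rate_cvg; case: (he i).
- split.
  + apply: continuous_subspaceT => s.
    apply: (@continuousM R R (fun=> 2 * C) (fun s => s ^+ 2)).
      exact: cst_continuous.
    exact: exprn_continuous.
  + move=> x y /set_mem[x0 _] /set_mem[y0 _] xy.
    by rewrite ltr_pM2l // ltrXn2r.
  + by rewrite expr0n mulr0.
move=> W bW; set w := linf_norm W; rewrite lte_fin !lt_min => /and3P[wd w1 wC].
move=> K GK k hstep.
have w0 : 0 <= w := le_trans (frob_ge0 _) (linf_norm_ge 0 bW).
have w2 : 2 * C * w ^+ 2 <= 1.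
  rewrite mulrC -ler_pdivlMr // div1r; apply: le_trans (ltW wC).
  by rewrite expr2 ler_piMl // ltW.
have s0 := size_ge0 hAB hQ hR GK.
(* An integer between U(0) and U(0) + 1, so that the i-th rate is active in
   beta at U(0). *)
pose i := (Num.truncn (lqr_size A B Q Rw (K 0%N))).+1.
have /andP[i1 i2] := truncn_itv s0.
have i4 : lqr_size A B Q Rw (K 0%N) <= i%:R by exact: ltW.
have i3 : i%:R <= lqr_size A B Q Rw (K 0%N) + 1.
  by rewrite /i -addn1 natrD; lra.
suff H : forall j, (j <= k)%N ->
    stabilizing A B (K j) /\ lqr_size A B Q Rw (K j) <=
      sigma i j * lqr_size A B Q Rw (K 0%N) + 2 * C * w ^+ 2.
  have [GKk sk] := H k (leqnn k); split=> //.
  apply: (le_trans sk); rewrite lerD2r mulrC; apply: beta_ge => //.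
  by move=> *; apply: decay_rate_gt0.
elim=> [_|j IH jk].
  split=> //; rewrite /sigma /decay_rate big_nil oppr0 mul0r expR0 mul1r.
  by rewrite lerDl mulr_ge0 ?sqr_ge0 // ltW.
have [GKj Kj] := IH (ltnW jk).
have [eta [eta0 eta1 lo_eta ->]] := hstep j jk.
have [] := step (K j) (W j) eta w GKj (linf_norm_ge j bW) wd eta0 eta1.
rewrite /gain_residual /greedy_gain => GL sL; split=> //; apply: le_trans sL _.
have e01 : eta <= 1 by move: eta1; rewrite le_min => /andP[].
have sj : sigma i j <= 1.
  have := decay_rate_dec (e i) (leq0n j).
  by rewrite {2}/decay_rate big_nil oppr0 mul0r expR0.
have ee : e i j <= eta.
  apply: le_trans lo_eta; have [hei _] := he i; apply: hei => //.
  apply: (tr_le_of_size hAB hQ hR GKj); apply: le_trans Kj _.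
  have : sigma i j * lqr_size A B Q Rw (K 0%N) <= lqr_size A B Q Rw (K 0%N).
    by rewrite ler_piMl.
  lra.
have h1 := decay_rateS ee (ltW eta0); rewrite -/(sigma i) in h1.
have h2 : (1 - eta / 2) * sigma i j * lqr_size A B Q Rw (K 0%N) <=
    sigma i j.+1 * lqr_size A B Q Rw (K 0%N) by rewrite ler_wpM2r.
have h3 : (1 - eta / 2) * lqr_size A B Q Rw (K j) <=
    (1 - eta / 2) * (sigma i j * lqr_size A B Q Rw (K 0%N) + 2 * C * w ^+ 2).
  by rewrite ler_wpM2l //; lra.
lra.
Qed.
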